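(* Consider Cramér's model with $n$ urns $U_1,\dots,U_n$, let $R_n$ be the length of the longest run of consecutive random composites $\le n$, and let $G_n=R_n+1$ be the maximal gap between random primes $\le n$. Put $\alpha_n=\dfrac{n}{\operatorname{li} n}$. Then there exist real sequences $a_n>0$ and $b_n$ with $$a_n\sim \alpha_n=\frac{n}{\operatorname{li} n},\qquad b_n\sim \alpha_n\log \operatorname{li} n\qquad (n\to\infty)$$ such that for every real $z$ $$\lim_{n\to\infty}P(G_n\le a_n z+b_n)=\exp(-e^{-z}).$$ Equivalently, for the longest runs of random composites, $\lim_{n\to\infty}P(R_n\le a_n z+b_n)=\exp(-e^{-z})$ for every real $z$.
   Context: Cramér's probabilistic model of primes: there is an infinite sequence of urns $U_1,U_2,U_3,\dots$ containing black and white balls, and one ball is drawn from each urn, the draws being independent. For $k\ge 3$, the ball drawn from $U_k$ is white with probability $\frac{1}{\log k}$ and black with probability $1-\frac1{\log k}$ ($\log$ is the natural logarithm). Convention: urn $U_1$ is empty (the integer $1$ is neither a random prime nor a random composite), and urn $U_2$ always produces a white ball. An integer $k$ is called a random prime (RP) if the ball drawn from $U_k$ is white, and a random composite (RC) if it is black. The model with $n$ urns uses only $U_1,\dots,U_n$. $R_n$ is the random variable equal to the largest length of a block of consecutive integers contained in $\{1,\dots,n\}$ all of which are random composites (runs of length $0$ are allowed, so $R_n=0$ if there are no random composites $\le n$). The maximal gap between random primes $\le n$ is by definition $G_n=R_n+1$. $\operatorname{li} x=\int_0^x\frac{dt}{\log t}$ (Cauchy principal value) $=\int_2^x \frac{dt}{\log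 t}+1.04516\ldots$ is the logarithmic integral. The notation $u_n\sim v_n$ means $u_n/v_n\to1$ as $n\to\infty$. *)

(* Defs.v *)
From HB Require Import structures.
From mathcomp Require Import all_boot all_order all_algebra.
From mathcomp Require Import all_classical all_reals all_analysis.
Set Implicit Arguments.
Unset Strict Implicit.
Unset Printing Implicit Defensive.
Import Order.TTheory GRing.Theory Num.Theory.
Import numFieldNormedType.Exports.
Local Open Scope classical_set_scope.
Local Open Scope ring_scope.

Definition mutually_independent (R : realType) (d d' : measure_display)
    (T : measurableType d) (T' : measurableType d') (P : probability T R)
    (D : set nat) (X : nat -> {RV P >-> T'}) : Prop :=
  forall (s : seq nat) (B : nat -> set T'),
    uniq s -> [set` s] `<=` D -> (forall k, measurable (B k)) ->
    P (\bigcap_(k in [set` s]) (X k @^-1` B k)) =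
      (\prod_(k <- s) P (X k @^-1` B k))%E.

(* [X k] is the colour of the ball drawn from urn [k], [true] meaning white.
   Urn 1 is empty and there is no urn 0, so [X 0] and [X 1] are unconstrained
   and are never looked at. *)
Record cramer_model (R : realType) (d : measure_display)
    (T : measurableType d) (P : probability T R)
    (X : nat -> {RV P >-> bool}) : Prop := CramerModel {
  cramer_indep : mutually_independent [set k | (2 <= k)%N] X ;
  cramer_urn2 : forall w, X 2 w = true ;
  cramer_urn : forall k, (3 <= k)%N ->
    P (X k @^-1` [set true]) = ((ln (k%:R : R))^-1)%:E }.

Section gaps.
Context {T : Type}.
Variable X : nat -> T -> bool.

Definition random_composite (w : T) (k : nat) : bool := (2 <= k)%N && ~~ X k w.

(* The block starting after [i] of length [m] is {i+1, ..., i+m}. *)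
Definition longest_run (n : nat) (w : T) : nat :=
  (\max_(i < n.+1)
    \max_(m < n.+1 | (i + m <= n) && all (random_composite w) (iota i.+1 m))
      m)%N.

Definition maximal_gap (n : nat) (w : T) : nat := (longest_run n w).+1.

End gaps.

(* Cauchy principal value at the singularity t = 1; at t = 0 the integrand is
   0 by the conventions ln 0 = 0 and 0^-1 = 0. *)
Definition li (R : realType) (x : R) : R :=
  lim ((\int[lebesgue_measure]_(t in `[0, x] `\` `]1 - e, 1 + e[) (ln t)^-1)
         @[e --> 0^'+]).

Definition asymp_equiv (R : realType) (u v : nat -> R) : Prop :=
  u n / v n @[n --> \oo] --> (1 : R).

(* Main.v *)
(* A run of at least [m] random composites starts right after a random prime
   [j] followed by [m] random composites; call this event A_j and let c_j be
   its probability. Two such events at distance at most [m] exclude each other,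
   and they are independent at larger distance, so F(N) = P(no A_i with i < N)
   satisfies exactly F(N+1) = F(N) - c_N F(N-m). As the c_j are uniformly
   small this forces F = exp (- sum c_j) + o(1). For [b_n] we take the least
   [m] for which the expected number lambda(m) = sum_{j <= n-m} c_j is at most
   1, and a_n = ln n. Almost all of lambda comes from j >= n / (ln n)^2, where
   ln j is equivalent to ln n, so lengthening [m] by k ~ z ln n multiplies
   lambda by (1 - 1 / ln n)^k ~ exp (-z); taking k = 1 gives lambda(b_n) -> 1,
   hence lambda(b_n + z ln n) -> exp (-z). Crude bounds on lambda give
   b_n ~ (ln n)^2. Finally li n ~ n / ln n because 1 / ln t - 1 / (t - 1) lies
   in [0, 1] and the principal value of 1 / (t - 1) on [0, x] is ln (x - 1). *)
Require Import Defs.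
From HB Require Import structures.
From mathcomp Require Import all_boot all_order all_algebra.
From mathcomp Require Import all_classical all_reals all_analysis.
From mathcomp Require Import measurable_realfun ring lra zify.
Import Order.TTheory GRing.Theory Num.Theory.
Import numFieldNormedType.Exports.
Local Open Scope classical_set_scope.
Local Open Scope ring_scope.

Set Implicit Arguments.
Unset Strict Implicit.
Unset Printing Implicit Defensive.

(** * Runs and independence *)

(** Anchoring a run at the prime on its left counts each maximal run of length at least [m] exactly
    once. *)
Definition run_start (m j : nat) (x : nat -> bool) : bool :=
  x j && all (fun k => ~~ x k) (iota j.+1 m).

Definition no_run (m N : nat) (x : nat -> bool) : bool :=
  all (fun j => ~~ run_start m j x) (index_iota 2 N).

Lemma no_runS m N x : (2 <= N)%N ->
  no_run m N.+1 x = no_run m N x && ~~ run_start m N x.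
Proof.
move=> N2; rewrite /no_run /index_iota subSn// -[(N - 2).+1]addn1 iotaD all_cat /= andbT.
by rewrite subnKC.
Qed.

Lemma run_startP m j (x : nat -> bool) :
  reflect (x j /\ forall k, (j < k <= j + m)%N -> ~~ x k) (run_start m j x).
Proof.
apply: (iffP andP) => -[xj /= H]; split=> //.
  by move=> k hk; apply: (allP H); rewrite mem_iota; lia.
by apply/allP => k; rewrite mem_iota => hk; apply: H; lia.
Qed.

Lemma no_runP m N (x : nat -> bool) :
  reflect (forall j, (2 <= j < N)%N -> ~~ run_start m j x) (no_run m N x).
Proof.
apply: (iffP allP) => H j.
  by move=> hj; apply: H; rewrite mem_index_iota.
by rewrite mem_index_iota => /H.
Qed.

(* Extending a run to the left until it meets a random prime, which exists
   because 2 is one. *)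
Lemma run_start_exists m i (x : nat -> bool) : (0 < m)%N -> x 2 ->
  (forall k, (i < k <= i + m)%N -> (2 <= k)%N && ~~ x k) ->
  exists j, (2 <= j <= i)%N /\ run_start m j x.
Proof.
move=> m0 x2; elim: i => [|i IH] H.
  by have /andP[] := H 1%N ltac:(lia).
have [i1|i1] := leqP i.+1 1.
  by have := H 2 ltac:(lia); rewrite x2.
have [xi|xi] := boolP (x i.+1).
  exists i.+1; split; first by lia.
  by apply/run_startP; split=> // k /H /andP[].
have [|j [hj rj]] := IH; last by exists j; split=> //; lia.
move=> k hk; have [->|ki] := eqVneq k i.+1; first by rewrite xi andbT.
by apply: H; lia.
Qed.

(** A block of [m] composites inside [{1, ..., n}] exists exactly when some [j] with
    [2 <= j <= n - m] starts a run; as [no_run] excludes its upper bound, this becomes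
    [(n - m).+1]. *)
Lemma longest_run_lt (T : Type) (X : nat -> T -> bool) (n m : nat) (w : T) :
  (0 < m)%N -> X 2 w ->
  (longest_run X n w < m)%N = no_run m (n - m).+1 (fun k => X k w).
Proof.
move=> m0 x2; apply/idP/idP => [lt_m|/no_runP noR].
  apply/no_runP => j hj; apply/negP => /run_startP[xj H].
  move: lt_m; rewrite ltnNge => /negP; apply.
  have jn : (j < n.+1)%N by lia.
  have mn : (m < n.+1)%N by lia.
  rewrite /longest_run.
  apply: (leq_trans _ (leq_bigmax (Ordinal jn))) => /=.
  apply: (leq_bigmax_cond (Ordinal mn)) => /=.
  apply/andP; split; first by lia.
  apply/allP => k; rewrite mem_iota /random_composite => hk.
  by rewrite H ?andbT; lia.
rewrite /longest_run -(prednK m0) ltnS.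
apply/bigmax_leqP => i _; apply/bigmax_leqP => l /andP[il /allP H].
rewrite leqNgt; apply/negP => ml.
have [] := @run_start_exists m i (fun k => X k w) m0 x2.
  by move=> k hk; apply: H; rewrite mem_iota; lia.
move=> j [hj rj]; have := noR j; rewrite rj.
by have := ltn_ord l; have := ltn_ord i; lia.
Qed.

(** * Predicates depending on finitely many urns *)

Definition cylinder (t : seq nat) (y x : nat -> bool) : bool :=
  all (fun k => x k == y k) t.

Definition depends_on (s : seq nat) (f : (nat -> bool) -> bool) : Prop :=
  forall u v : nat -> bool, {in s, u =1 v} -> f u = f v.

(** Freezing a coordinate removes it from the support of a predicate; this drives the inductions on
    the support in [measurable_event] and [pr_indep]. *)
Definition setval (k : nat) (b : bool) (x : nat -> bool) : nat -> bool :=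
  fun i => if i == k then b else x i.

Lemma setval_id k b x : x k = b -> setval k b x = x.
Proof. by move=> <-; apply/funext => i; rewrite /setval; case: eqP => [->|]. Qed.

Lemma depends_on_setval k b s f :
  depends_on (k :: s) f -> depends_on s (f \o setval k b).
Proof.
move=> df u v uv /=; apply: df => i; rewrite inE /setval.
by case: eqP => //= _ /uv.
Qed.

Lemma depends_on_sub s s' f : {subset s <= s'} ->
  depends_on s f -> depends_on s' f.
Proof. by move=> ss' df u v uv; apply: df => i /ss' /uv. Qed.

Lemma depends_on_and s f g : depends_on s f -> depends_on s g ->
  depends_on s (fun x => f x && g x).
Proof. by move=> df dg u v uv; rewrite (df _ _ uv) (dg _ _ uv). Qed.

Lemma depends_on_run_start m j : depends_on (iota j m.+1) (run_start m j).
Proof.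
move=> u v uv; rewrite /run_start; congr andb.
  by apply: uv; rewrite inE eqxx.
by apply: eq_in_all => k hk; congr negb; apply: uv; rewrite inE hk orbT.
Qed.

Lemma depends_on_no_run m N : depends_on (index_iota 2 (N + m)) (no_run m N).
Proof.
move=> u v uv; apply: eq_in_all => j; rewrite mem_index_iota => hj.
congr negb; apply: depends_on_run_start => k; rewrite mem_iota => hk.
by apply: uv; rewrite mem_index_iota; lia.
Qed.

(** The product that independence assigns to [run_start m j]. It is stated for an arbitrary sequence
    [p], so that the estimates below involve no probability space. *)
Definition run_prob (R : realType) (p : nat -> R) (m j : nat) : R :=
  p j * \prod_(j.+1 <= i < (j + m).+1) (1 - p i).

(** * Block independence and the recursion for the absence of runs *)

Section CramerProbability.
Context (R : realType) (d : measure_display) (T : measurableType d)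
  (P : probability T R) (X : nat -> {RV P >-> bool}) (hX : cramer_model X).

Definition event (f : (nat -> bool) -> bool) : set T :=
  [set w | f (fun k => X k w)].

Definition pr (f : (nat -> bool) -> bool) : R := fine (P (event f)).

(** The event is split by the colour of urn [k]; on each piece [f] agrees with its frozen version,
    whose support is shorter. *)
Lemma measurable_event s f : depends_on s f -> measurable (event f).
Proof.
elim: s f => [|k s IH] f df.
  (* With empty support [f] is constant; [xpredT] is an arbitrary point at which to read its
     value. *)
  have [f1|f0] := boolP (f xpredT).
    rewrite (_ : event f = setT) //; apply/seteqP; split=> // w _.
    by rewrite /event /= (df _ xpredT).
  rewrite (_ : event f = set0) //; apply/seteqP; split=> // w.
  by rewrite /event /= (df _ xpredT)// (negbTE f0).
have mk b : measurable (X k @^-1` [set b]).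
  by rewrite -[X in measurable X]setTI; apply: measurable_funPT.
have mb b : measurable (X k @^-1` [set b] `&` event (f \o setval k b)).
  by apply: measurableI => //; apply: IH; exact: depends_on_setval.
rewrite (_ : event f = (X k @^-1` [set true] `&` event (f \o setval k true)) `|`
    (X k @^-1` [set false] `&` event (f \o setval k false))).
  exact: measurableU.
apply/seteqP; split=> [w fw|w [] [/= wb]]; rewrite /event /= ?(setval_id wb)//.
by case E: (X k w); [left|right]; split=> //=; rewrite (setval_id E).
Qed.

Lemma prE s f : depends_on s f -> P (event f) = (pr f)%:E.
Proof.
by move=> df; rewrite /pr fineK// fin_num_measure//; exact: measurable_event df.
Qed.

Lemma pr_ge0 f : 0 <= pr f.
Proof. by rewrite /pr fine_ge0. Qed.

Lemma pr_le1 s f : depends_on s f -> pr f <= 1.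
Proof.
move=> df; rewrite -lee_fin -(prE df); apply: probability_le1.
exact: measurable_event df.
Qed.

Lemma eq_pr f g : f =1 g -> pr f = pr g.
Proof. by move=> /funext ->. Qed.

Lemma pr_split s f g : depends_on s f -> depends_on s g ->
  pr f = pr (fun x => f x && g x) + pr (fun x => f x && ~~ g x).
Proof.
move=> df dg.
have dfg := depends_on_and df dg.
have dfn : depends_on s (fun x => f x && ~~ g x).
  by apply: depends_on_and => // u v uv; rewrite (dg _ _ uv).
apply: EFin_inj; rewrite EFinD -(prE df) -(prE dfg) -(prE dfn).
rewrite -measureU; [|exact: measurable_event dfg|exact: measurable_event dfn|].
  congr (P _); apply/seteqP; split=> w; rewrite /event /=.
    by case: (g _) => ->; [left|right].
  by case=> /andP[].
by apply/seteqP; split=> // w; rewrite /event /= => -[/andP[_ ->] /andP[_]].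
Qed.

Definition urn (k : nat) (b : bool) : R := pr (fun x => x k == b).

Lemma depends_on_coord s k b : k \in s -> depends_on s (fun x => x k == b).
Proof. by move=> ks u v ->. Qed.

Lemma depends_on_cylinder t y : depends_on t (cylinder t y).
Proof. by move=> u v uv; apply: eq_in_all => k /uv ->. Qed.

Lemma pr_cylinder t y : uniq t -> all (leq 2) t ->
  pr (cylinder t y) = \prod_(k <- t) urn k (y k).
Proof.
move=> ut /allP t2; apply: EFin_inj.
rewrite -(prE (@depends_on_cylinder t y)).
have /= := @cramer_indep _ _ _ _ _ hX t (fun k => [set (y k)]) ut.
move=> /(_ _ (fun k => I)) H.
rewrite (_ : event _ = \bigcap_(k in [set` t]) X k @^-1` [set y k]).
  rewrite H; last by move=> k /t2.
  rewrite -prodEFin; apply: eq_bigr => k _.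
  rewrite -(@prE [:: k]); last exact/depends_on_coord/mem_head.
  by congr (P _); apply/seteqP; split=> w; rewrite /event /= => /eqP.
apply/seteqP; split=> w; rewrite /event /=.
  by move=> /allP H1 k /H1/eqP.
by move=> H1; apply/allP => k /H1 /= ->.
Qed.

(* A predicate is the disjoint union of its two restrictions to the values of
   one coordinate; moving that coordinate into the cylinder and inducting
   reduces block independence to the product rule for cylinders. *)
Lemma pr_indep s t y f : uniq (s ++ t) -> all (leq 2) (s ++ t) ->
  depends_on s f ->
  pr (fun x => f x && cylinder t y x) = pr f * pr (cylinder t y).
Proof.
elim: s t y f => [|k s IH] t y f ust st2 df.
  have [f1|f0] := boolP (f xpredT).
    rewrite (_ : (fun x => _) = cylinder t y); last first.
      by apply/funext => x; rewrite (df _ xpredT)// f1.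
    rewrite [pr f](_ : _ = 1) ?mul1r// /pr (_ : event f = setT).
      by rewrite probability_setT.
    by apply/seteqP; split=> // w _; rewrite /event /= (df _ xpredT).
  have f00 x : f x = false by rewrite (df _ xpredT)//; exact/negbTE.
  have pr0 : pr (fun=> false) = 0.
    rewrite /pr (_ : event _ = set0) ?measure0//.
    by apply/seteqP; split.
  by rewrite (@eq_pr f (fun=> false))// (@eq_pr _ (fun=> false)) ?pr0 ?mul0r// => x;
    rewrite f00.
have /= /andP[kst ust'] := ust; have /= /andP[k2 st2'] := st2.
have kt : k \notin t by move: kst; rewrite mem_cat negb_or => /andP[].
have split_k (g : (nat -> bool) -> bool) : depends_on (k :: s ++ t) g ->
    pr g = pr (fun x => g x && (x k == true)) + pr (fun x => g x && (x k == false)).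
  move=> dg; rewrite (pr_split dg (@depends_on_coord _ k true (mem_head _ _))).
  by congr (_ + _); apply: eq_pr => x; rewrite (eqbF_neg (x k)) eqb_id.
have cyl_k b t' : k \notin t' -> forall x,
    (x k == b) && cylinder t' y x = cylinder (k :: t') (setval k b y) x.
  move=> kt' x; rewrite /cylinder /= {1}/setval eqxx; congr andb.
  apply: eq_in_all => i it; rewrite /setval; case: (eqVneq i k) => // ik.
  by rewrite -ik it in kt'.
have f_k b x : f x && (x k == b) = (f \o setval k b) x && (x k == b).
  by case: eqP => xk; rewrite ?andbF// /= setval_id.
(* Where [x k = b], [f] can be replaced by its frozen version, while the condition on [x k] joins
   the cylinder; the induction hypothesis then applies. *)
have step b t' : uniq (s ++ k :: t') -> all (leq 2) (s ++ k :: t') ->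
    k \notin t' ->
    pr (fun x => (f x && cylinder t' y x) && (x k == b)) =
    pr (f \o setval k b) * (urn k b * pr (cylinder t' y)).
  move=> u1 a1 kt'.
  have [ut' at'] : uniq t' /\ all (leq 2) t'.
    move: u1 a1; rewrite cat_uniq all_cat /=.
    by move=> /and3P[_ _ /andP[_ ->]] /and3P[_ _ ->].
  transitivity (pr (fun x => (f \o setval k b) x &&
      cylinder (k :: t') (setval k b y) x)).
    apply: eq_pr => x; rewrite -cyl_k// andbA -f_k -andbA (andbC (cylinder _ _ _)).
    by rewrite andbA.
  rewrite IH//; last exact: depends_on_setval.
  congr (_ * _); rewrite !pr_cylinder//=; last 2 first.
    by rewrite kt' ut'.
    by rewrite k2 at'.
  rewrite big_cons {1}/setval eqxx; congr (_ * _).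
  apply: eq_big_seq => i it; rewrite /setval; case: (eqVneq i k) => // ik.
  by rewrite -ik it in kt'.
have uskt : uniq (s ++ k :: t) by rewrite (perm_uniq (permEl (perm_catCA s [:: k] t) : perm_eq (s ++ k :: t) (k :: s ++ t))).
have askt : all (leq 2) (s ++ k :: t) by move: st2'; rewrite !all_cat /= k2.
have usk : uniq (s ++ [:: k]).
  move: uskt; rewrite !cat_uniq /= !orbF => /and3P[-> + _] /=.
  by rewrite negb_or andbT => /andP[].
have ask : all (leq 2) (s ++ [:: k]).
  by move: askt; rewrite !all_cat /= andbT => /andP[-> /andP[->]].
rewrite (split_k (fun x => f x && _)); last first.
  apply: depends_on_and; first by apply: (depends_on_sub _ df) => i; rewrite -cat_cons mem_cat => ->.
  apply: (depends_on_sub _ (@depends_on_cylinder t y)) => i.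
  by rewrite -cat_cons mem_cat => ->; rewrite orbT.
rewrite !step// (split_k f); last first.
  by apply: (depends_on_sub _ df) => i; rewrite -cat_cons mem_cat => ->.
(* The same identity with an empty cylinder expands [pr f], and the two expansions differ by the
   factor [pr (cylinder t y)]. *)
have f_nil b : pr (fun x => f x && (x k == b)) = pr (f \o setval k b) * urn k b.
  transitivity (pr (fun x => (f x && cylinder [::] y x) && (x k == b))).
    by apply: eq_pr => x; rewrite /= andbT.
  by rewrite step// pr_cylinder// big_nil mulr1.
by rewrite !f_nil; ring.
Qed.

Definition prime_prob (k : nat) : R := urn k true.

Lemma prime_prob_ge0 k : 0 <= prime_prob k.
Proof. exact: pr_ge0. Qed.

Lemma prime_prob_le1 k : prime_prob k <= 1.
Proof. exact/(@pr_le1 [:: k])/depends_on_coord/mem_head. Qed.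

Lemma prime_prob_ln k : (3 <= k)%N -> prime_prob k = (ln (k%:R : R))^-1.
Proof.
move=> k3; apply: EFin_inj; rewrite -(cramer_urn hX k3).
rewrite -(@prE [:: k]); last exact/depends_on_coord/mem_head.
by congr (P _); apply/seteqP; split=> w; rewrite /event /= => /eqP.
Qed.

Lemma urn_false k : urn k false = 1 - prime_prob k.
Proof.
have : pr (fun=> true) = 1.
  rewrite /pr (_ : event _ = setT) ?probability_setT//.
  by apply/seteqP; split.
rewrite (@pr_split [:: k] _ (fun x => x k == true)) //; last first.
  exact/depends_on_coord/mem_head.
rewrite /prime_prob => <-; rewrite -/(urn k true) addrAC subrr add0r.
by apply: eq_pr => x; rewrite eqbF_neg eqb_id.
Qed.

(** The pattern [k == j] is white at [j] and black afterwards, so the product rule and [pr_indep]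
    apply to run starts. *)
Lemma run_start_cylinder m j x :
  run_start m j x = cylinder (iota j m.+1) (fun k => k == j) x.
Proof.
rewrite /run_start /cylinder /= eqxx eqb_id; congr andb.
apply: eq_in_all => k; rewrite mem_iota => hk.
by rewrite (_ : (k == j) = false) ?eqbF_neg//; lia.
Qed.

Lemma pr_run_start m j : (2 <= j)%N -> pr (run_start m j) = run_prob prime_prob m j.
Proof.
move=> j2; rewrite (@eq_pr _ _ (run_start_cylinder m j)) pr_cylinder//; last 2 first.
- exact: iota_uniq.
- by apply/allP => k; rewrite mem_iota; lia.
rewrite -[iota j m.+1]/(j :: iota j.+1 m) big_cons eqxx /run_prob; congr (_ * _).
rewrite (_ : iota j.+1 m = index_iota j.+1 (j + m).+1); last first.
  by rewrite /index_iota; congr iota; lia.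
rewrite big_seq [RHS]big_seq; apply: eq_bigr => k; rewrite mem_index_iota => hk.
by rewrite -urn_false (_ : (k == j) = false)//; lia.
Qed.

Lemma no_run_le m N N' x : (N' <= N)%N -> no_run m N x -> no_run m N' x.
Proof. by move=> NN /no_runP H; apply/no_runP => j hj; apply: H; lia. Qed.

(* Two runs starting at distance at most m exclude each other. *)
Lemma no_run_run_start m N x : (2 <= N)%N ->
  no_run m N x && run_start m N x = no_run m (N - m) x && run_start m N x.
Proof.
move=> N2; apply/andP/andP => -[H rN]; split=> //.
  by apply: no_run_le H; lia.
have [xN HN] := run_startP _ _ _ rN.
apply/no_runP => j hj; have [jm|jm] := ltnP j (N - m).
  by apply: (no_runP _ _ _ H); lia.
by apply/negP => /run_startP[_] /(_ N); rewrite xN; lia.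
Qed.

(** Given a run start at [N], only starts below [N - m] remain to be excluded. These involve urns
    below [N], whereas the run at [N] involves urns [N] to [N + m], so the two events are
    independent. *)
Lemma pr_no_run_rec m N : (2 <= N)%N ->
  pr (no_run m N.+1) = pr (no_run m N) - run_prob prime_prob m N * pr (no_run m (N - m)).
Proof.
move=> N2; rewrite -pr_run_start//.
have dr : depends_on (index_iota 2 (N + m).+1) (run_start m N).
  apply: (depends_on_sub _ (@depends_on_run_start m N)) => i.
  by rewrite mem_iota mem_index_iota; lia.
have dn : depends_on (index_iota 2 (N + m).+1) (no_run m N).
  apply: (depends_on_sub _ (@depends_on_no_run m N)) => i.
  by rewrite !mem_index_iota; lia.
rewrite (pr_split dn dr) (@eq_pr (no_run m N.+1)
  (fun x => no_run m N x && ~~ run_start m N x)); last by move=> x; rewrite no_runS.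
rewrite (@eq_pr (fun x => no_run m N x && run_start m N x)
  (fun x => no_run m (N - m) x && cylinder (iota N m.+1) (fun k => k == N) x)); last first.
  by move=> x; rewrite no_run_run_start// run_start_cylinder.
rewrite (@pr_indep (index_iota 2 N)).
- by rewrite (@eq_pr _ _ (run_start_cylinder m N)); ring.
- rewrite (_ : _ ++ _ = index_iota 2 (N + m).+1) ?iota_uniq//.
  rewrite /index_iota (_ : ((N + m).+1 - 2 = (N - 2) + m.+1)%N) ?iotaD; last by lia.
  by congr (_ ++ iota _ _); lia.
- by apply/allP => k; rewrite mem_cat mem_index_iota mem_iota; lia.
(* When [N < m] the truncated difference is 0, and [no_run m 0] is constantly true. *)
have [mN|Nm] := leqP m N.
  by rewrite -{1}(subnK mN); exact: depends_on_no_run.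
move=> u v _; rewrite (_ : (N - m)%N = 0%N); last by lia.
by rewrite /no_run.
Qed.

Lemma pr_no_run_small m N : (N <= 2)%N -> pr (no_run m N) = 1.
Proof.
move=> N2; rewrite /pr (_ : event _ = setT) ?probability_setT//.
apply/seteqP; split=> // w _; rewrite /event /=.
by apply/no_runP => j; lia.
Qed.

Lemma pr_no_run_le m N N' : (N' <= N)%N -> pr (no_run m N) <= pr (no_run m N').
Proof.
move=> NN; have dN := @depends_on_no_run m N; have dN' := @depends_on_no_run m N'.
rewrite -lee_fin -(prE dN) -(prE dN'); apply: le_measure.
- by rewrite inE; exact: measurable_event dN.
- by rewrite inE; exact: measurable_event dN'.
by move=> w; exact: no_run_le.
Qed.

Lemma prob_longest_run_lt n m : (0 < m)%N ->
  P [set w | (longest_run X n w < m)%N] = (pr (no_run m (n - m).+1))%:E.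
Proof.
move=> m0; rewrite -(prE (@depends_on_no_run _ _)); congr (P _).
by apply/seteqP; split=> w; rewrite /event /= longest_run_lt// (cramer_urn2 hX).
Qed.

End CramerProbability.

Lemma run_prob_ge0 (R : realType) (p : nat -> R) m j :
  (forall k, 0 <= p k) -> (forall k, p k <= 1) -> 0 <= run_prob p m j.
Proof.
move=> p0 p1; rewrite mulr_ge0 ?p0// prodr_ge0// => i _.
by rewrite subr_ge0 p1.
Qed.

(* Since [F] varies by at most [m * eta] on a window of length [m], the
   recursion is [F N.+1 = (1 - c N) * F N] up to an error [c N * m * eta]. *)
Lemma delayed_recursion_approx (R : realType) (F c : nat -> R) (m N : nat) (eta : R) :
  (forall i, 0 <= F i <= 1) -> (forall i j, (i <= j)%N -> F j <= F i) ->
  (forall i, (i <= 2)%N -> F i = 1) ->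
  (forall i, (2 <= i)%N -> F i.+1 = F i - c i * F (i - m)%N) ->
  (forall i, 0 <= c i) -> (forall i, (2 <= i < N)%N -> c i <= eta) ->
  0 <= eta <= 1 ->
  0 <= expR (- \sum_(2 <= j < N) c j) - F N <=
    m.+1%:R * eta * \sum_(2 <= j < N) c j.
Proof.
move=> F01 Fdec F1 Frec c0 ceta /andP[eta0 eta1].
(* One step of the recursion lowers [F] by at most [eta], because [F <= 1]; for indices up to 2, [F]
   is constant. *)
have Fdrop i k : (i <= N)%N -> F (i - k)%N <= F i + k%:R * eta.
  move=> iN; elim: k => [|k IH]; first by rewrite subn0 mul0r addr0.
  have [ik|ki] := leqP (i - k) 2.
    rewrite (F1 (i - k.+1)%N); last by lia.
    move: IH; rewrite (F1 (i - k)%N)// => /le_trans; apply.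
    by rewrite lerD2l ler_wpM2r// ler_nat.
  have := Frec (i - k.+1)%N; rewrite (_ : (i - k.+1).+1 = (i - k)%N); last by lia.
  move=> /(_ _)H; rewrite -[X in X <= _](subrK (F (i - k)%N)) H; last by lia.
  rewrite opprB addrC [X in _ + X](_ : _ = c (i - k.+1)%N * F (i - k.+1 - m)%N); last by ring.
  rewrite -natr1 mulrDl mul1r addrA lerD//.
    by rewrite -H//; lia.
  have /andP[f0 f1] := F01 (i - k.+1 - m)%N.
  apply: (le_trans (ler_piMr _ f1)) => //; apply: ceta; lia.
elim: N ceta Fdrop => [|N IH] ceta Fdrop.
  by rewrite big_geq// oppr0 expR0 F1// subrr mulr0 lexx.
have [N2|N2] := leqP N.+1 2.
  by rewrite big_geq// oppr0 expR0 F1// subrr mulr0 lexx.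
have /andP[IH0 IH1] := IH (fun i hi => ceta i ltac:(lia))
  (fun i k hi => Fdrop i k ltac:(lia)).
rewrite big_nat_recr//=; set S := \sum_(2 <= j < N) c j in IH0 IH1 *.
have cN : c N <= eta by apply: ceta; lia.
have c0N := c0 N; rewrite Frec; last by lia.
have FN1 := Fdrop N m ltac:(lia).
have FN2 := Fdec (N - m)%N N ltac:(lia).
have /andP[F0 _] := F01 N.
have E0 : 0 < expR (- S) := expR_gt0 _.
have S0 : 0 <= S by exact: sumr_ge0.
have E1 : expR (- S) <= 1 by rewrite expR_le1 oppr_le0.
rewrite opprD expRD.
have e1 : 1 - c N <= expR (- c N) by exact: expR_ge1Dx.
(* This follows from [(1 + c) * expR (- c) <= 1] and [(1 + c) * (1 - c + c ^+ 2) = 1 + c ^+ 3]. The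
   quadratic term costs at most [c * eta], which turns the factor [m] of the delay into [m.+1]. *)
have e2 : expR (- c N) <= 1 - c N + c N ^+ 2.
  have h : (1 + c N) * expR (- c N) <= 1.
    by rewrite -[leRHS](expRxMexpNx_1 (c N)) ler_wpM2r ?expR_ge0// expR_ge1Dx.
  have : (1 + c N) * (1 - c N + c N ^+ 2) >= 1.
    by rewrite (_ : _ * _ = 1 + c N ^+ 3) ?lerDl ?exprn_ge0//; ring.
  move=> h2; rewrite -(ler_pM2l (_ : 0 < 1 + c N)); last by lra.
  exact: le_trans h h2.
set E := expR (- S) in E0 E1 IH0 IH1 *; set e := expR _ in e1 e2 *.
set x := c N in cN c0N e1 e2 *; set f := F N in IH0 IH1 FN1 FN2 F0 *.
set g := F (N - m)%N in FN1 FN2 *.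
have me : 0 <= m%:R * eta by rewrite mulr_ge0.
have xg : x * f <= x * g by exact: ler_wpM2l.
have xg2 : x * g <= x * (f + m%:R * eta) by exact: ler_wpM2l.
have Ee : E * (1 - x) <= E * e by apply: ler_wpM2l => //; exact: ltW.
have Ee2 : E * e <= E * (1 - x + x ^+ 2) by apply: ler_wpM2l => //; exact: ltW.
have xE : 0 <= (1 - x) * (E - f) by apply: mulr_ge0 => //; lra.
have xE2 : 0 <= x * (E - f) by apply: mulr_ge0.
have xx : E * x ^+ 2 <= x * eta.
  apply: (@le_trans _ _ (x ^+ 2)); first by rewrite ler_piMl ?sqr_ge0.
  by rewrite expr2 ler_wpM2l.
rewrite -natr1 in IH1 *; apply/andP; split; nra.
Qed.

(** * The expected number of runs *)

Lemma cvgry_ln (R : realType) : @ln R x @[x --> +oo] --> +oo.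
Proof.
apply/cvgryPge => A; near=> x.
have x0 : 0 < x by near: x; exact: nbhs_pinfty_gt.
rewrite -(expRK A) ler_ln ?posrE ?expR_gt0//.
Unshelve. all: by end_near. Qed.

Lemma cvgnry_ln (R : realType) : @ln R n%:R @[n --> \oo] --> +oo.
Proof. exact: (cvg_comp _ _ cvgr_idn (@cvgry_ln R)). Qed.

Lemma cvgr_inv_pinfty (R : realType) : (x : R)^-1 @[x --> +oo] --> 0.
Proof.
apply/cvgr0Pnorm_le => e e0; near=> x.
have x0 : 0 < x by near: x; exact: nbhs_pinfty_gt.
rewrite ger0_norm; last by rewrite invr_ge0 ltW.
rewrite invf_ple ?posrE//.

Unshelve. all: by end_near. Qed.

(** The exponential series gives [expR x >= x ^+ k.+1 / k.+1!], so the product is at most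
    [k.+1! / x]. *)
Lemma cvgr_pow_expRN (R : realType) k :
  (x : R) ^+ k * expR (- x) @[x --> +oo] --> 0.
Proof.
have h : k.+1`!%:R * (x : R)^-1 @[x --> +oo] --> 0.
  by rewrite -(mulr0 k.+1`!%:R); apply: cvgMr; exact: cvgr_inv_pinfty.
apply: (squeeze_cvgr _ (cvg_cst 0) h); near=> x.
have x0 : 0 < x by near: x; exact: nbhs_pinfty_gt.
have x0' := ltW x0; rewrite mulr_ge0 ?exprn_ge0 ?expR_ge0//=.
rewrite expRN ler_pdivrMr ?expR_gt0// mulrAC ler_pdivlMr//.
rewrite -exprSr -ler_pdivrMl ?ltr0n ?fact_gt0// mulrC.
by apply: le_trans (expR_ge1Dxn k (ltW x0)); rewrite lerDr.
Unshelve. all: by end_near. Qed.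

Lemma cvgr_ln_div (R : realType) : ln (x : R) / x @[x --> +oo] --> 0.
Proof.
have := cvg_comp _ _ (@cvgry_ln R) (@cvgr_pow_expRN R 1).
apply: cvg_trans; apply: near_eq_cvg; near=> x => /=.
by rewrite expr1 expRN lnK// posrE; near: x; exact: nbhs_pinfty_gt.
Unshelve. all: by end_near. Qed.

Lemma cvgnr_ln_pow_div (R : realType) k :
  @ln R n%:R ^+ k / n%:R @[n --> \oo] --> 0.
Proof.
have := cvg_comp _ _ (@cvgnry_ln R) (@cvgr_pow_expRN R k).
apply: cvg_trans; apply: near_eq_cvg; near=> n => /=.
rewrite expRN lnK// posrE ltr0n; near: n; exact: nbhs_infty_gt.
Unshelve. all: by end_near. Qed.

(** The inverse of [1 - y^-1] is [1 + (y - 1)^-1], at most [expR ((y - 1)^-1)]. With the next lemma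
    this encloses the power between exponentials with denominators [y - 1] and [y]. *)
Lemma expR_le_onem_exp (R : realType) (y : R) m : 1 < y ->
  expR (- (m%:R / (y - 1))) <= (1 - y^-1) ^+ m.
Proof.
move=> y1; rewrite -mulrN expRM_natl lerXn2r ?nnegrE ?expR_ge0//.
  by rewrite subr_ge0 invf_le1 ?ltW//; lra.
have y10 : 0 < y - 1 by rewrite subr_gt0.
rewrite expRN invf_ple ?posrE ?expR_gt0//; last first.
  by rewrite subr_gt0 invf_lt1//; lra.
rewrite (_ : (1 - y^-1)^-1 = 1 + (y - 1)^-1) ?expR_ge1Dx//.
have y0 : y != 0 by rewrite gt_eqF//; lra.
by field; rewrite y0 gt_eqF.
Qed.

Lemma onem_exp_le_expR (R : realType) (y : R) m : 1 <= y ->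
  (1 - y^-1) ^+ m <= expR (- (m%:R / y)).
Proof.
move=> y1; rewrite -mulrN expRM_natl lerXn2r ?nnegrE ?expR_ge0 ?expR_ge1Dx//.
by rewrite subr_ge0 invf_le1//; lra.
Qed.

(** * Bounds on the expected number of runs for fixed n *)

Section ExpectedRuns.
Context (R : realType) (p : nat -> R) (p0 : forall k, 0 <= p k) (p1 : forall k, p k <= 1)
  (p_ln : forall k, (3 <= k)%N -> p k = (ln (k%:R : R))^-1).
Local Notation L n := (ln (n%:R : R)).

(* The expected number of maximal runs of length at least [m]. *)
Definition mean_runs (m n : nat) : R := \sum_(2 <= j < (n - m).+1) run_prob p m j.

Let rp0 m j : 0 <= run_prob p m j.
Proof. exact: run_prob_ge0. Qed.

(** Read off from [p k <= 1], since [p k] is the inverse of [ln k]. *)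
Lemma ln_nat_ge1 k : (3 <= k)%N -> 1 <= L k.
Proof.
move=> k3; have := p1 k; rewrite p_ln// invf_le1// ln_gt0// ltr1n; lia.
Qed.

Lemma le_ln_nat j k : (0 < j)%N -> (j <= k)%N -> L j <= L k.
Proof. by move=> j0 jk; rewrite ler_ln ?posrE ?ltr0n ?ler_nat//; lia. Qed.

Lemma composite_prob_le n i : (3 <= i <= n)%N -> 1 - p i <= 1 - (L n)^-1.
Proof.
move=> hi; rewrite lerD2l lerN2 p_ln; last by lia.
have hi1 : 1 <= L i by apply: ln_nat_ge1; lia.
have hn1 : 1 <= L n by apply: ln_nat_ge1; lia.
by rewrite lef_pV2 ?posrE; [apply: le_ln_nat; lia|lra|lra].
Qed.

Lemma composite_prob_ge J i : (3 <= J <= i)%N -> 1 - (L J)^-1 <= 1 - p i.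
Proof.
by move=> hi; rewrite -p_ln ?[p i]p_ln; [apply: composite_prob_le|..]; lia.
Qed.

Lemma onem_invln_ge0 n : (3 <= n)%N -> 0 <= 1 - (L n)^-1.
Proof. by move=> n3; rewrite -p_ln// subr_ge0. Qed.

Lemma run_probD m k j : run_prob p (m + k) j =
  run_prob p m j * \prod_((j + m).+1 <= i < (j + m + k).+1) (1 - p i).
Proof.
rewrite /run_prob -mulrA -big_cat_nat ?addnA//=; lia.
Qed.

(** The [k] additional factors [1 - p i] have [i <= n], and [p] decreases; [run_probD_ge] is the
    counterpart using [i >= J]. *)
Lemma run_probD_le m k j n : (2 <= j)%N -> (j + m + k <= n)%N ->
  run_prob p (m + k) j <= run_prob p m j * (1 - (L n)^-1) ^+ k.
Proof.
move=> j2 jn; have [->|k0] := posnP k; first by rewrite addn0 mulr1.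
rewrite run_probD ler_wpM2l//.
have -> : (1 - (L n)^-1) ^+ k =
    \prod_((j + m).+1 <= i < (j + m + k).+1) (1 - (L n)^-1).
  by rewrite prodr_const_nat; congr (_ ^+ _); lia.
rewrite big_seq [leRHS]big_seq; apply: ler_prod => i; rewrite mem_index_iota => hi.
by rewrite subr_ge0 p1 composite_prob_le//; lia.
Qed.

Lemma run_probD_ge m k j J : (3 <= J <= j)%N ->
  run_prob p m j * (1 - (L J)^-1) ^+ k <= run_prob p (m + k) j.
Proof.
move=> hJ; rewrite run_probD ler_wpM2l//.
have -> : (1 - (L J)^-1) ^+ k =
    \prod_((j + m).+1 <= i < (j + m + k).+1) (1 - (L J)^-1).
  by rewrite prodr_const_nat; congr (_ ^+ _); lia.
rewrite big_seq [leRHS]big_seq; apply: ler_prod => i; rewrite mem_index_iota => hi.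
by rewrite onem_invln_ge0 ?composite_prob_ge//; lia.
Qed.

Lemma run_prob0 j : run_prob p 0 j = p j.
Proof. by rewrite /run_prob addn0 big_geq// mulr1. Qed.

Lemma run_prob_le m j n : (2 <= j)%N -> (j + m <= n)%N ->
  run_prob p m j <= (1 - (L n)^-1) ^+ m.
Proof.
move=> j2 jn; have := @run_probD_le 0 m j n j2; rewrite addn0 add0n run_prob0 => /(_ jn).
have [->|m0] := posnP m; first by rewrite expr0 mulr1 => /le_trans; apply.
by move=> /le_trans; apply; rewrite ler_piMl// exprn_ge0// onem_invln_ge0//; lia.
Qed.

Lemma mean_runs_ge0 m n : 0 <= mean_runs m n.
Proof. exact: sumr_ge0. Qed.

Lemma mean_runsD_le m k n : (3 <= n)%N ->
  mean_runs (m + k) n <= mean_runs m n * (1 - (L n)^-1) ^+ k.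
Proof.
move=> n3; have q0 := onem_invln_ge0 n3.
rewrite /mean_runs mulr_suml.
apply: (@le_trans _ _ (\sum_(2 <= j < (n - (m + k)).+1)
    run_prob p m j * (1 - (L n)^-1) ^+ k)).
  rewrite big_seq [leRHS]big_seq; apply: ler_sum => j; rewrite mem_index_iota => hj.
  by apply: run_probD_le; lia.
have [h|h] := leqP (n - (m + k)).+1 2.
  by rewrite big_geq// sumr_ge0// => j _; rewrite mulr_ge0 ?exprn_ge0.
rewrite [leRHS](big_cat_nat (n := (n - (m + k)).+1))/=; [|lia|lia].
by rewrite lerDl sumr_ge0// => j _; rewrite mulr_ge0 ?exprn_ge0.
Qed.

Lemma sum_run_prob_le m n i j : (2 <= i)%N -> (j <= (n - m).+1)%N ->
  \sum_(i <= l < j) run_prob p m l <= (1 - (L n)^-1) ^+ m *+ (j - i).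
Proof.
move=> i2 jn; rewrite -sumr_const_nat big_seq [leRHS]big_seq.
apply: ler_sum => l; rewrite mem_index_iota => hl; apply: run_prob_le; lia.
Qed.

Lemma mean_runs_le m n : (3 <= n)%N ->
  mean_runs m n <= n%:R * (1 - (L n)^-1) ^+ m.
Proof.
move=> n3; apply: le_trans (sum_run_prob_le _ (leqnn _)) _ => //.
rewrite mulr_natl; apply: ler_wpMn2l; last by lia.
by rewrite exprn_ge0 ?onem_invln_ge0.
Qed.

(** Starts below [J] and the last [k] starts are discarded, each of probability at most
    [(1 - (L n)^-1) ^+ m]. Every other run survives the extension with factor at least
    [(1 - (L J)^-1) ^+ k]. *)
Lemma mean_runsD_ge m k n J : (3 <= J <= n)%N ->
  (mean_runs m n - (J + k)%:R * (1 - (L n)^-1) ^+ m) * (1 - (L J)^-1) ^+ k <=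
  mean_runs (m + k) n.
Proof.
move=> hJ; have qJ : 0 <= 1 - (L J)^-1 by apply: onem_invln_ge0; lia.
have qn : 0 <= 1 - (L n)^-1 by apply: onem_invln_ge0; lia.
have eta0 : 0 <= (1 - (L n)^-1) ^+ m by exact: exprn_ge0.
(* Here every start is discarded, so the left side is at most 0. *)
have [h|h] := leqP (n - (m + k)).+1 J.
  apply: (@le_trans _ _ 0); last exact: mean_runs_ge0.
  rewrite mulr_le0_ge0 ?exprn_ge0// subr_le0.
  apply: le_trans (sum_run_prob_le _ (leqnn _)) _ => //.
  rewrite mulr_natl; apply: ler_wpMn2l => //; lia.
have -> : mean_runs m n = \sum_(2 <= j < J) run_prob p m j +
    (\sum_(J <= j < (n - (m + k)).+1) run_prob p m j +
     \sum_((n - (m + k)).+1 <= j < (n - m).+1) run_prob p m j).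
  rewrite -big_cat_nat/=; [|lia|lia].
  by rewrite -big_cat_nat/=; [|lia|lia].
rewrite [leRHS](big_cat_nat (n := J))/=; [|lia|lia].
have s1 : \sum_(2 <= j < J) run_prob p m j <= J%:R * (1 - (L n)^-1) ^+ m.
  apply: (le_trans (@sum_run_prob_le m n 2 J _ _)); [by []|lia|].
  by rewrite mulr_natl; apply: ler_wpMn2l => //; lia.
have s2 : \sum_((n - (m + k)).+1 <= j < (n - m).+1) run_prob p m j <=
    k%:R * (1 - (L n)^-1) ^+ m.
  apply: (le_trans (@sum_run_prob_le m n _ _ _ _)); [lia|lia|].
  by rewrite mulr_natl; apply: ler_wpMn2l => //; lia.
have s3 : (\sum_(J <= j < (n - (m + k)).+1) run_prob p m j) * (1 - (L J)^-1) ^+ k <=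
    \sum_(J <= j < (n - (m + k)).+1) run_prob p (m + k) j.
  rewrite mulr_suml big_seq [leRHS]big_seq; apply: ler_sum => j.
  by rewrite mem_index_iota => hj; apply: run_probD_ge; lia.
have s4 : 0 <= \sum_(2 <= j < J) run_prob p (m + k) j by exact: sumr_ge0.
apply: le_trans (le_trans s3 _); last by rewrite lerDr.
rewrite ler_wpM2r ?exprn_ge0// natrD mulrDl; lra.
Qed.

(** One has [n <= 3 * n./2] for [n >= 2], and 3 is at most [expR 2]. *)
Lemma ln_half_ge n : (2 <= n)%N -> L n - 2 <= L n./2.
Proof.
move=> n2; rewrite lerBlDr -[X in _ + X](expRK 2) -lnM ?posrE ?expR_gt0//; last first.
  by rewrite ltr0n; lia.
rewrite ler_ln ?posrE ?mulr_gt0 ?expR_gt0 ?ltr0n//; [|lia|lia].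
apply: (@le_trans _ _ (n./2%:R * 3)).
  by rewrite -natrM ler_nat; lia.
by rewrite ler_wpM2l//; have := expR_ge1Dx (2 : R); lra.
Qed.

(* On [j >= n / 2] one has [L j - 1 >= L n - 3], and
   [m / (L n - 3) <= m / L n + 12] in the given range of [m]. *)
Lemma mean_runs_ge m n : 6 <= L n -> (8 <= n)%N -> (4 * m <= n)%N ->
  m%:R <= 2 * L n ^+ 2 ->
  n%:R / 4 / L n * (expR (- 12) * expR (- (m%:R / L n))) <= mean_runs m n.
Proof.
move=> L6 n8 mn mL.
have half := ln_half_ge (ltac:(lia) : (2 <= n)%N).
set h := n./2 in half *.
have h3 : (3 <= h)%N by rewrite /h; lia.
apply: (@le_trans _ _ (\sum_(h <= j < (n - m).+1)
    (L n)^-1 * (expR (- 12) * expR (- (m%:R / L n))))); last first.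
  rewrite /mean_runs [leRHS](big_cat_nat (n := h))/=; [|lia|lia].
  rewrite -[leLHS]add0r lerD//; first exact: sumr_ge0.
  rewrite big_seq [leRHS]big_seq; apply: ler_sum => j; rewrite mem_index_iota => hj.
  have := @run_probD_ge 0 m j h; rewrite add0n run_prob0 => H.
  apply: le_trans (H _); last by lia.
  rewrite p_ln; last by lia.
  apply: ler_pM.
  - by rewrite invr_ge0; lra.
  - by rewrite mulr_ge0 ?expR_ge0.
  - have Lj : 1 <= L j by apply: ln_nat_ge1; lia.
    by rewrite lef_pV2 ?posrE; [apply: le_ln_nat; lia|lra|lra].
  apply: le_trans (expR_le_onem_exp _ _); last by lra.
  rewrite -expRD ler_expR -opprD lerN2.
  apply: (@le_trans _ _ (m%:R / (L n - 3))).
    rewrite ler_wpM2l// lef_pV2 ?posrE; lra.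
  rewrite ler_pdivrMr; last by lra.
  rewrite mulrDl (mulrBr (m%:R / L n)) divfK; last by rewrite gt_eqF//; lra.
  (* With this bound the claim reduces to [6 * L n <= 12 * L n - 36], that is, to [6 <= L n]. *)
  have : m%:R / L n <= 2 * L n.
    by rewrite ler_pdivrMr; [rewrite -mulrA -expr2|lra].
  lra.
rewrite sumr_const_nat -[leRHS]mulr_natl -!mulrA [leLHS]mulrA ler_wpM2r//.
  by rewrite !mulr_ge0 ?expR_ge0// invr_ge0; lra.
(* At least [n / 4] starts lie between [n / 2] and [n - m], because [m <= n / 4]. *)
have : (n <= 4 * ((n - m).+1 - h))%N by rewrite /h; lia.
by rewrite -(ler_nat R) natrM; lra.
Qed.

Lemma typical_run_subproof n : exists m, mean_runs m n <= 1.
Proof. by exists n; rewrite /mean_runs subnn big_geq. Qed.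

(* The centering sequence [b_n]. *)
Definition typical_run n : nat := ex_minn (typical_run_subproof n).

Lemma mean_runs_typical_run n : mean_runs (typical_run n) n <= 1.
Proof. by rewrite /typical_run; case: ex_minnP. Qed.

Lemma mean_runs_gt1 m n : (m < typical_run n)%N -> 1 < mean_runs m n.
Proof.
rewrite /typical_run; case: ex_minnP => M _ H mM; rewrite ltNge.
by apply/negP => /H; rewrite leqNgt mM.
Qed.

(** The mean is at most [n * expR (- (m / L n))], which drops to 1 once [m >= L n ^+ 2]. *)
Lemma typical_run_le n : (3 <= n)%N -> (typical_run n)%:R <= L n ^+ 2 + 1.
Proof.
move=> n3; have L1 := ln_nat_ge1 n3; set m := (Num.truncn (L n ^+ 2)).+1.
have /andP[m1 m2] := @truncn_itv _ (L n ^+ 2) (sqr_ge0 _).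
apply: (@le_trans _ _ m%:R); last by rewrite /m -natr1 lerD2r.
rewrite ler_nat leqNgt; apply/negP => /mean_runs_gt1; apply/negP.
rewrite -leNgt; apply: (le_trans (mean_runs_le m n3)).
apply: (@le_trans _ _ (expR (L n) * expR (- (m%:R / L n)))).
  rewrite lnK ?posrE ?ltr0n ?ler_wpM2l ?onem_exp_le_expR//; lia.
rewrite -expRD expR_le1 subr_le0 ler_pdivlMr; last by lra.
by rewrite -expr2; exact: ltW.
Qed.

(** The lower bound [mean_runs_ge] is solved for the exponential, the mean at [typical_run n] being
    at most 1. *)
Lemma expR_typical_run n : 6 <= L n -> (8 <= n)%N -> 4 * (L n ^+ 2 + 1) <= n%:R ->
  expR (- ((typical_run n)%:R / L n)) <= 4 * expR 12 * (L n / n%:R).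
Proof.
move=> L6 n8 nL; have n3 : (3 <= n)%N by lia.
have M1 := typical_run_le n3.
have := @mean_runs_ge (typical_run n) n L6 n8 _ _.
have M2 : (4 * typical_run n <= n)%N.
  by rewrite -(ler_nat R) natrM; apply: le_trans nL; rewrite ler_wpM2l.
have M3 : (typical_run n)%:R <= 2 * L n ^+ 2.
  by apply: (le_trans M1); have : 1 <= L n ^+ 2; [rewrite expr_ge1//; lra|lra].
move=> /(_ M2 M3) /le_trans /(_ (mean_runs_typical_run n)).
set E := expR (- (_ / _)) => H.
have e12 := expR_gt0 (12 : R); have n0 : 0 < (n%:R : R) by rewrite ltr0n; lia.
have L0 : 0 < L n by lra.
rewrite -[leRHS]mulr1; apply: le_trans (ler_wpM2l _ H); last first.
  by rewrite !mulr_ge0 ?invr_ge0// ltW.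
rewrite expRN le_eqVlt; apply/orP; left; apply/eqP; field.
by rewrite !gt_eqF.
Qed.

End ExpectedRuns.

(** * Asymptotics of the expected number of runs *)

Section MeanRunsAsymptotics.
Context (R : realType) (p : nat -> R) (p0 : forall k, 0 <= p k)
  (p1 : forall k, p k <= 1)
  (p_ln : forall k, (3 <= k)%N -> p k = (ln (k%:R : R))^-1).
Local Notation L n := (ln (n%:R : R)).
Local Notation M := (typical_run p).

Lemma near_ln_ge (A : R) : \forall n \near \oo, A <= L n.
Proof. by have /cvgryPge := @cvgnry_ln R; apply. Qed.

Lemma cvgn_invln : (L n)^-1 @[n --> \oo] --> 0.
Proof. exact: (cvg_comp _ _ (@cvgnry_ln R) (@cvgr_inv_pinfty R)). Qed.

Lemma cvgn_lnln_div : ln (L n) / L n @[n --> \oo] --> 0.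
Proof. exact: (cvg_comp _ _ (@cvgnry_ln R) (@cvgr_ln_div R)). Qed.

Lemma near_typical_run_bound : \forall n \near \oo,
  expR (- ((M n)%:R / L n)) <= 4 * expR 12 * (L n / n%:R).
Proof.
have h : 4 * (L n ^+ 2 / n%:R + n%:R^-1) @[n --> \oo] --> 4 * (0 + 0 : R).
  apply: cvgMr.
  apply: cvgD; first exact: cvgnr_ln_pow_div.
  exact: (cvg_comp _ _ cvgr_idn (@cvgr_inv_pinfty R)).
rewrite addr0 mulr0 in h; near=> n; apply: expR_typical_run => //.
- by near: n; exact: near_ln_ge.
- by near: n; exact: nbhs_infty_ge.
have n0 : 0 < (n%:R : R).
  by rewrite ltr0n; near: n; exact: nbhs_infty_gt.
rewrite -[leRHS]mul1r -ler_pdivrMr// -mulrA (mulrDl (L n ^+ 2)) mul1r.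
near: n; exact: (cvgr_le _ h).
Unshelve. all: by end_near. Qed.

(** The upper bound is [typical_run_le]. The logarithm of [near_typical_run_bound] gives the lower
    bound [M n / L n >= L n - ln (L n) - ln (4 * expR 12)]. *)
Lemma cvgn_typical_run : (M n)%:R / L n ^+ 2 @[n --> \oo] --> (1 : R).
Proof.
have lo : 1 - ln (L n) / L n - ln (4 * expR 12) * (L n)^-1 @[n --> \oo] --> (1 - 0 - ln (4 * expR 12) * 0 : R).
  apply: cvgB; last by apply: cvgMr; exact: cvgn_invln.
  by apply: cvgB; [exact: cvg_cst|exact: cvgn_lnln_div].
have up : 1 + (L n)^-1 * (L n)^-1 @[n --> \oo] --> (1 + 0 * 0 : R).
  apply: cvgD; first exact: cvg_cst.
  by apply: cvgM; exact: cvgn_invln.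
rewrite !subr0 mulr0 subr0 in lo; rewrite mulr0 addr0 in up.
apply: (squeeze_cvgr _ lo up); near=> n.
have L1 : 1 <= L n by near: n; exact: near_ln_ge.
have L0 : 0 < L n by lra.
have n3 : (3 <= n)%N by near: n; exact: nbhs_infty_ge.
have n0 : 0 < (n%:R : R) by rewrite ltr0n; lia.
apply/andP; split; last first.
  rewrite ler_pdivrMr ?exprn_gt0// mulrDl mul1r -expr2 -exprMn mulVf ?gt_eqF//.
  by rewrite expr1n; exact: typical_run_le.
have e12 := expR_gt0 (12 : R).
have : ln (expR (- ((M n)%:R / L n))) <= ln (4 * expR 12 * (L n / n%:R)).
  rewrite ler_ln ?posrE ?expR_gt0 ?mulr_gt0 ?invr_gt0//.
  by near: n; exact: near_typical_run_bound.
rewrite expRK lnM ?posrE ?mulr_gt0 ?invr_gt0// ln_div ?posrE// => H.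
rewrite ler_pdivlMr ?exprn_gt0//.
move: H; rewrite lerNl ler_pdivlMr//.
rewrite (_ : (1 - _ - _) * _ = - (ln (4 * expR 12) + (ln (L n) - L n)) * L n)//.
by field; rewrite gt_eqF.
Unshelve. all: by end_near. Qed.

(* The terms [j < n / L n ^ 2] and the last [k] terms are negligible, and on
   the others [L j] is [L n * (1 + o(1))]. *)
Lemma cvgn_mean_runs_ratio (B k : nat -> nat) (y K : R) :
  (k n)%:R / L n @[n --> \oo] --> y ->
  (\forall n \near \oo, expR (- ((B n)%:R / L n)) <= K * (L n / n%:R)) ->
  (\forall n \near \oo, 1 <= mean_runs p (B n) n) ->
  mean_runs p (B n + k n) n / mean_runs p (B n) n @[n --> \oo] --> expR (- y).
Proof.
move=> ky BK B1.
have up : expR (- ((k n)%:R / L n)) @[n --> \oo] --> expR (- y).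
  by apply: continuous_cvg; [exact: continuous_expR|exact: cvgN].
(* Chosen so that [L n * lnJ n = ln (n / L n ^+ 2) - 1], a lower bound for [L J - 1] with the cutoff
   [J] just above [n / L n ^+ 2]. *)
pose lnJ n := 1 - ln (L n) / L n * 2 - (L n)^-1.
have lnJ1 : lnJ n @[n --> \oo] --> (1 - 0 * 2 - 0 : R).
  apply: cvgB; last exact: cvgn_invln.
  apply: cvgB; first exact: cvg_cst.
  by apply: cvgMl; exact: cvgn_lnln_div.
rewrite mul0r !subr0 in lnJ1.
(* This is [(n / L n ^+ 2 + 1 + k n) * (K * (L n / n))], which dominates the loss
   [(J + k n) * (1 - (L n)^-1) ^+ B n] of [mean_runsD_ge]. *)
pose err n := K * ((L n)^-1 + L n ^+ 1 / n%:R + (k n)%:R / L n * (L n ^+ 2 / n%:R)).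
have err0 : err n @[n --> \oo] --> K * (0 + 0 + y * 0).
  apply: cvgMr.
  apply: cvgD; last by apply: cvgM => //; exact: cvgnr_ln_pow_div.
  by apply: cvgD; [exact: cvgn_invln|exact: cvgnr_ln_pow_div].
rewrite mulr0 !addr0 mulr0 in err0.
have lo : (1 - err n) * expR (- ((k n)%:R / L n / lnJ n)) @[n --> \oo] -->
    (1 - 0) * expR (- (y / 1)).
  apply: cvgM; first by apply: cvgB; [exact: cvg_cst|exact: err0].
  apply: continuous_cvg; first exact: continuous_expR.
  apply: cvgN; apply: cvgM => //.
  by apply: cvgV => //; exact: oner_neq0.
rewrite subr0 mul1r divr1 in lo.
apply: (squeeze_cvgr _ lo up); near=> n.
have n3 : (3 <= n)%N by near: n; exact: nbhs_infty_ge.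
have n0 : 0 < (n%:R : R) by rewrite ltr0n; lia.
have L2 : 2 <= L n by near: n; exact: near_ln_ge.
have L0 : 0 < L n by lra.
have lam1 : 1 <= mean_runs p (B n) n by near: n.
have lam0 : 0 < mean_runs p (B n) n by lra.
have BKn : expR (- ((B n)%:R / L n)) <= K * (L n / n%:R) by near: n.
have e1 : err n <= 1 by near: n; apply: (cvgr_le _ err0).
have J1 : 2^-1 <= lnJ n by near: n; apply: (cvgr_ge _ lnJ1); rewrite invf_lt1//; lra.
have nL3 : 3 <= n%:R / L n ^+ 2.
  have : L n ^+ 2 / n%:R <= 3^-1.
    by near: n; apply: (cvgr_le _ (@cvgnr_ln_pow_div R 2)); rewrite invr_gt0.
  by rewrite -[leLHS]invf_div lef_pV2 ?posrE ?divr_gt0 ?exprn_gt0.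
apply/andP; split; last first.
  rewrite ler_pdivrMr// mulrC.
  apply: (le_trans (mean_runsD_le p0 p1 p_ln _ _ n3)).
  by rewrite ler_wpM2l ?mean_runs_ge0// onem_exp_le_expR//; lra.
pose J := (Num.truncn (n%:R / L n ^+ 2)).+1.
have x0 : 0 <= n%:R / L n ^+ 2 by lra.
have /andP[Jlo Jup] := truncn_itv x0.
have J3 : (3 <= J <= n)%N.
  apply/andP; split; first by rewrite /J ltnS truncn_ge_nat//; lra.
  rewrite /J truncn_lt_nat// ltr_pdivrMr ?exprn_gt0// ltr_pMr//.
  by rewrite exprn_egt1//; lra.
rewrite ler_pdivlMr//.
apply: le_trans (mean_runsD_ge p0 p1 p_ln (B n) (k n) J3).
have LJ : L n * (lnJ n) <= L J - 1.
  have : ln (n%:R / L n ^+ 2) <= L J.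
    by rewrite ler_ln ?posrE ?ltr0n ?divr_gt0 ?exprn_gt0// ltW.
  rewrite ln_div ?posrE ?exprn_gt0// lnXn//.
  rewrite (_ : L n * lnJ n = L n - ln (L n) *+ 2 - 1); first by lra.
  by rewrite /lnJ; field; rewrite gt_eqF.
have LJ1 : 1 < L J.
  by have : 0 < L n * lnJ n; [rewrite mulr_gt0//; lra|lra].
rewrite mulrAC; apply: ler_pM.
- by rewrite mulr_ge0 ?expR_ge0//; lra.
- exact: expR_ge0.
- have eta0 : 0 <= (1 - (L n)^-1) ^+ B n.
    by rewrite exprn_ge0// (onem_invln_ge0 p1 p_ln n3).
  have : (J + k n)%:R * (1 - (L n)^-1) ^+ B n <= err n.
    rewrite (_ : err n = (n%:R / L n ^+ 2 + 1 + (k n)%:R) * (K * (L n / n%:R))).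
      apply: ler_pM => //; first by rewrite natrD lerD2r /J -natr1 lerD2r.
      by apply: le_trans BKn; apply: onem_exp_le_expR; lra.
    by rewrite /err; field; rewrite !gt_eqF.
  have : 0 <= (J + k n)%:R * (1 - (L n)^-1) ^+ B n by rewrite mulr_ge0.
  set e := _ * _ => e0 ee; have err_ge0 := le_trans e0 ee.
  (* Since the mean at [B n] is at least 1, the absolute loss is also a relative one. *)
  have : err n * 1 <= err n * mean_runs p (B n) n by rewrite ler_wpM2l.
  by rewrite mulrBl; lra.
apply: le_trans (expR_le_onem_exp _ LJ1).
have LL0 : 0 < L n * lnJ n by rewrite mulr_gt0//; lra.
have LJ0 : 0 < L J - 1 by rewrite subr_gt0.
by rewrite ler_expR lerN2 -mulrA -invfM ler_wpM2l// lef_pV2 ?posrE.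
Unshelve. all: by end_near. Qed.

(* All lengths are compared with the common smaller length
   [M n - (shift n)], so that only nonnegative shifts occur. *)
Lemma cvgn_mean_runs (m : nat -> nat) (z : R) :
  ((m n)%:R - (M n)%:R) / L n @[n --> \oo] --> z ->
  mean_runs p (m n) n @[n --> \oo] --> expR (- z).
Proof.
(* The margin over [|z|] ensures that [M n - shift n] is eventually at most [m n]. *)
move=> mz; pose C := `|z| + 2.
pose shift n := (Num.truncn (C * L n)).+1.
have C0 : 0 <= C by rewrite addr_ge0.
have zC : - C < z - 1.
  by rewrite /C; have := ler_norm (- z); rewrite normrN; lra.
have shiftC : (shift n)%:R / L n @[n --> \oo] --> C.
  have up : C + (L n)^-1 @[n --> \oo] --> C + 0.
    by apply: cvgD; [exact: cvg_cst|exact: cvgn_invln].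
  rewrite addr0 in up.
  apply: (squeeze_cvgr _ (cvg_cst C) up); near=> n.
  have L0 : 0 < L n by near: n; apply: filterS (near_ln_ge 1) => n; lra.
  have CL : 0 <= C * L n by rewrite mulr_ge0// ltW.
  have /andP[h1 h2] := truncn_itv CL.
  rewrite ler_pdivlMr// (ltW h2)/= ler_pdivrMr// mulrDl mulVf ?gt_eqF//.
  by rewrite /shift -natr1 lerD2r.
have MoL : \forall n \near \oo, (shift n < M n)%N.
  have h : (L n)^-1 * ((shift n)%:R / L n) @[n --> \oo] --> 0 * C.
    by apply: cvgM => //; exact: cvgn_invln.
  rewrite mul0r in h; near=> n.
  have L0 : 0 < L n by near: n; apply: filterS (near_ln_ge 1) => n; lra.
  rewrite -(ltr_nat R) -(@ltr_pM2r _ (L n ^+ 2)^-1) ?invr_gt0 ?exprn_gt0//.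
  apply: (@lt_trans _ _ 2^-1); last first.
    near: n; apply: (cvgr_gt _ cvgn_typical_run); rewrite invf_lt1//; lra.
  rewrite (_ : _ / _ = (L n)^-1 * ((shift n)%:R / L n)).
    by near: n; apply: (cvgr_lt _ h); rewrite invr_gt0.
  by rewrite expr2 invfM mulrCA mulrA.
pose B n := (M n - shift n)%N.
have [K BK] : exists K, \forall n \near \oo,
    expR (- ((B n)%:R / L n)) <= K * (L n / n%:R).
  exists (expR (C + 1) * (4 * expR 12)); near=> n.
  have sM : (shift n < M n)%N by near: n.
  rewrite /B natrB ?(ltnW sM)// mulrBl opprB expRD -[leRHS]mulrA.
  apply: ler_pM; rewrite ?expR_ge0// ?ler_expR.
    by near: n; apply: (cvgr_le _ shiftC); lra.
  by near: n; exact: near_typical_run_bound.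
have lamM n : (B n < M n)%N -> 1 <= mean_runs p (B n) n.
  by move=> BM; rewrite ltW// mean_runs_gt1.
have B1 : \forall n \near \oo, 1 <= mean_runs p (B n) n.
  near=> n; apply: lamM; rewrite /B; have : (shift n < M n)%N by near: n.
  by rewrite /shift; lia.
have ratio k y : (k n)%:R / L n @[n --> \oo] --> y ->
    mean_runs p (B n + k n) n / mean_runs p (B n) n @[n --> \oo] --> expR (- y).
  by move=> ky; exact: cvgn_mean_runs_ratio ky BK B1.
have rM := ratio _ _ shiftC.
(* Length [M n - 1], the last one at which the mean exceeds 1, has the same limiting ratio as
   [M n]. *)
have rM1 : mean_runs p (B n + (shift n).-1) n / mean_runs p (B n) n @[n --> \oo]
    --> expR (- C).
  apply: ratio; have h : (shift n)%:R / L n - (L n)^-1 @[n --> \oo] --> C - 0.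
    by apply: cvgB => //; exact: cvgn_invln.
  rewrite subr0 in h; apply: cvg_trans h; apply: near_eq_cvg; near=> n.
  by rewrite /shift -natr1 mulrDl mul1r addrK.
have B_le_m : \forall n \near \oo, (B n <= m n)%N.
  near=> n.
  have sM : (shift n < M n)%N by near: n.
  have L0 : 0 < L n by near: n; apply: filterS (near_ln_ge 1) => n; lra.
  have h1 : - C <= ((m n)%:R - (M n)%:R) / L n.
    by near: n; apply: (cvgr_ge _ mz); lra.
  have CL : 0 <= C * L n by rewrite mulr_ge0// ltW.
  have /andP[_ h2] := truncn_itv CL.
  rewrite -(ler_nat R) /B natrB ?(ltnW sM)//.
  move: h1; rewrite ler_pdivlMr// mulNr /shift; lra.
have rm : mean_runs p (B n + (m n - B n)) n / mean_runs p (B n) n @[n --> \oo]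
    --> expR (- (z + C)).
  apply: ratio.
  have h : ((m n)%:R - (M n)%:R) / L n + (shift n)%:R / L n @[n --> \oo] --> z + C.
    exact: cvgD.
  apply: cvg_trans h; apply: near_eq_cvg; near=> n.
  have sM : (shift n < M n)%N by near: n.
  have Bm : (B n <= m n)%N by near: n.
  by rewrite natrB// /B natrB ?(ltnW sM)//= -mulrDl; congr (_ / _); ring.
have eC0 : expR (- C) != 0 by rewrite gt_eqF ?expR_gt0.
(* The mean at [M n] is at most 1 and the mean at [M n - 1] exceeds 1, while their quotient tends to
   1. *)
have Mto1 : mean_runs p (M n) n @[n --> \oo] --> (1 : R).
  have h : mean_runs p (B n + shift n) n / mean_runs p (B n) n /
      (mean_runs p (B n + (shift n).-1) n / mean_runs p (B n) n) @[n --> \oo]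
      --> expR (- C) / expR (- C).
    by apply: cvgM => //; exact: cvgV.
  rewrite divff// in h; apply: (squeeze_cvgr _ h (cvg_cst (1 : R))); near=> n.
  have sM : (shift n < M n)%N by near: n.
  have -> : (B n + shift n = M n)%N by rewrite /B; lia.
  have gt1 : 1 < mean_runs p (B n + (shift n).-1) n.
    by apply: mean_runs_gt1; rewrite /B /shift; move: sM; rewrite /shift; lia.
  have lB : 1 <= mean_runs p (B n) n by near: n.
  rewrite mean_runs_typical_run andbT invf_div mulrA divfK; last by rewrite gt_eqF//; lra.
  rewrite ler_pdivrMr; last by lra.
  by rewrite ler_peMr ?mean_runs_ge0// ltW.
have h : mean_runs p (B n + (m n - B n)) n / mean_runs p (B n) n /
    (mean_runs p (B n + shift n) n / mean_runs p (B n) n) * mean_runs p (M n) n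
    @[n --> \oo] --> expR (- (z + C)) / expR (- C) * 1.
  by apply: cvgM => //; apply: cvgM => //; exact: cvgV.
move: h; rewrite opprD expRD mulfK// mulr1; apply: cvg_trans.
apply: near_eq_cvg; near=> n.
have sM : (shift n < M n)%N by near: n.
have Bm : (B n <= m n)%N by near: n.
have lB : 1 <= mean_runs p (B n) n by near: n.
have lM : 2^-1 <= mean_runs p (M n) n.
  by near: n; apply: (cvgr_ge _ Mto1); rewrite invf_lt1//; lra.
have -> : (B n + shift n = M n)%N by rewrite /B; lia.
rewrite subnKC//; field.
by apply/andP; split; rewrite gt_eqF//; lra.
Unshelve. all: by end_near. Qed.
End MeanRunsAsymptotics.

(** * The logarithmic integral *)

Section LogarithmicIntegral.
Context (R : realType).
Local Notation mu := (@lebesgue_measure R).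

Lemma measurable_invr : measurable_fun [set: R] (@GRing.inv R).
Proof.
rewrite -(setUv [set (0 : R)]); apply/measurable_funU => //.
  exact: measurableC.
split; first exact: measurable_fun_set1.
apply: open_continuous_measurable_fun.
  by rewrite openC; exact: closed_eq.
by move=> x; rewrite inE /= => /eqP x0; exact: inv_continuous.
Qed.

(* [1 / ln t] minus its polar part at [t = 1]. *)
Definition regular_part (t : R) : R := (ln t)^-1 - (t - 1)^-1.

(** Over the common denominator [ln t * (t - 1)], which is positive for [t != 1], the two bounds
    become [ln t <= t - 1] and [t - 1 <= t * ln t]. *)
Lemma regular_part_bound t : 0 <= t -> 0 <= regular_part t <= 1.
Proof.
(* At [t = 0] and [t = 1] the conventions for [ln 0] and [0^-1] give the values 1 and 0. *)
rewrite le_eqVlt => /predU1P[<-|t0].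
  by rewrite /regular_part ln0// invr0 !sub0r invrN1 opprK ler01 lexx.
have [->|t1] := eqVneq t 1; first by rewrite /regular_part ln1 subrr subrr ler01 lexx.
have up : ln t <= t - 1 by have := @le_ln1Dx _ (t - 1); rewrite [1 + _]addrC subrK; apply; lra.
have lo : (t - 1) / t <= ln t.
  have := @le_ln1Dx _ (t^-1 - 1); rewrite [1 + _]addrC subrK lnV ?posrE//.
  have -> : (t - 1) / t = 1 - t^-1 by rewrite mulrBl divff ?gt_eqF// mul1r.
  have tV0 : 0 < t^-1 by rewrite invr_gt0.
  by move=> H; have {}H := H ltac:(lra); lra.
have lnt0 : ln t != 0 by rewrite ln_eq0.
have t10 : t - 1 != 0 by rewrite subr_eq0.
have -> : regular_part t = (t - 1 - ln t) / (ln t * (t - 1)).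
  by rewrite /regular_part; field; rewrite ?lnt0 ?t10.
have pos : 0 < ln t * (t - 1).
  have [t1'|t1'] := ltP 1 t; first by rewrite mulr_gt0 ?ln_gt0 ?subr_gt0.
  have {}t1' : t < 1 by rewrite lt_neqAle t1.
  by rewrite nmulr_rgt0 ?ln_lt0 ?t0 ?subr_lt0.
rewrite divr_ge0 ?(ltW pos)//=; last lra.
rewrite ler_pdivrMr// mul1r.
have : t - 1 <= ln t * t by rewrite -ler_pdivrMr.
lra.
Qed.

Lemma measurable_regular_part D : measurable D -> measurable_fun D regular_part.
Proof.
move=> mD; apply: measurable_funTS; apply: measurable_funB.
  exact: (measurableT_comp measurable_invr (@measurable_ln R)).
apply: (measurableT_comp measurable_invr).
by apply: measurable_funB.
Qed.

Lemma integrable_regular_part (x : R) D : measurable D -> D `<=` `[0, x] ->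
  mu.-integrable D (EFin \o regular_part).
Proof.
move=> mD Dx; apply: (@integrableS _ _ _ mu `[0, x]) => //.
apply: measurable_bounded_integrable => //.
- by apply: compact_finite_measure; exact: segment_compact.
- exact: measurable_regular_part.
exists 1; split; first by rewrite realE ler01.
move=> M M1 t /=; rewrite in_itv /= => /andP[t0 _].
have /andP[r0 r1] := regular_part_bound t0.
by rewrite ger0_norm//; lra.
Qed.

(** The sign [s] of [t - 1] lets one antiderivative, [ln (s * (t - 1))], serve on both sides of the
    pole. *)
Lemma Rintegral_inv_subr1 (s a b : R) : a < b -> s * s = 1 ->
  (forall t, a <= t <= b -> 0 < s * (t - 1)) ->
  \int[mu]_(t in `[a, b]) (t - 1)^-1 = ln (s * (b - 1)) - ln (s * (a - 1)).
Proof.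
move=> ab ss pos.
have t1 t : a <= t <= b -> t - 1 != 0.
  by move=> /pos h; apply/eqP => t0; rewrite t0 mulr0 ltxx in h.
have dF t : a <= t <= b -> is_derive t 1 (fun t : R => ln (s * (t - 1))) (t - 1)^-1.
  move=> tab; have h := is_derive1_ln (pos _ tab).
  have h' : is_derive t (1 : R) (s \*: ((id : R -> R) - cst 1)) s.
    by apply: is_derive_eq; rewrite subr0 /GRing.scale /= mulr1.
  apply: (is_derive_eq (@is_derive1_comp _ (@ln R) (s \*: ((id : R -> R) - cst 1)) t _ _ h h')).
  have s0 : s != 0 by apply/eqP => s0; move: ss; rewrite s0 mul0r; lra.
  by field; rewrite t1.
have cF t : a <= t <= b -> {for t, continuous (fun t : R => ln (s * (t - 1)))}.
  by move=> /dF [] + _; move/derivable1_diffP/differentiable_continuous.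
have cf : {within `[a, b], continuous (fun t : R => (t - 1)^-1)}.
  apply: continuous_in_subspaceT => t; rewrite inE /= in_itv /= => /t1 t10.
  by apply: cvgV => //; apply: cvgB; [exact: cvg_id|exact: cvg_cst].
rewrite /Rintegral (continuous_FTC2 (F := fun t : R => ln (s * (t - 1))) ab cf)//.
  split.
  - by move=> t; rewrite in_itv /= => /andP[ta tb]; have [] := dF t ltac:(by rewrite !ltW).
  - by apply: cvg_at_right_filter; apply: cF; rewrite lexx ltW.
  - by apply: cvg_at_left_filter; apply: cF; rewrite lexx ltW.
move=> t; rewrite in_itv /= => /andP[ta tb]; rewrite derive1E.
by have [_ ->] := dF t ltac:(by rewrite !ltW).
Qed.

Lemma itv_setD_punctured (x e : R) : 0 < e -> e < 1 -> 1 + e < x ->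
  `[0, x] `\` `]1 - e, 1 + e[ = `[0, 1 - e] `|` `[1 + e, x] :> set R.
Proof.
move=> e0 e1 ex; apply/seteqP; split=> t /=; rewrite !in_itv /=.
  move=> [/andP[t0 tx] /negP]; rewrite negb_and -!leNgt => /orP[h|h].
    by left; rewrite t0.
  by right; rewrite h.
move=> [/andP[h1 h2]|/andP[h1 h2]]; split; try (by apply/andP; split; lra);
  apply/negP; rewrite negb_and -!leNgt; apply/orP; by [left|right].
Qed.

Lemma Rintegral_regular_part_itv (x : R) (i : interval R) :
  [set` i] `<=` `[0, x] ->
  0 <= \int[mu]_(t in [set` i]) regular_part t <= fine (mu [set` i]).
Proof.
move=> ix; have mi : measurable [set` i] by [].
have b t : [set` i] t -> 0 <= regular_part t <= 1.
  by move=> /ix; rewrite /= in_itv /= => /andP[t0 _]; exact: regular_part_bound.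
apply/andP; split.
  by apply: Rintegral_ge0 => t /b /andP[].
rewrite -[leRHS]mul1r -Rintegral_cst//; apply: le_Rintegral => //.
- exact: integrable_regular_part ix.
- apply: (@integrableS _ _ _ mu `[0, x]) => //.
  apply: continuous_compact_integrable; first exact: segment_compact.
  by apply: continuous_subspaceT => ?; exact: cvg_cst.
by move=> t /b /andP[].
Qed.

Lemma fine_lebesgue_measure_itv (b0 b1 : bool) (a b : R) : a <= b ->
  fine (mu [set` Interval (BSide b0 a) (BSide b1 b)]) = b - a.
Proof.
move=> ab; rewrite lebesgue_measure_itv /= lte_fin.
by case: ltP => // ba; rewrite (le_anti (_ : a <= b <= a)) ?subrr// ab.
Qed.

(* The polar parts of the two sides of the singularity cancel exactly, so the
   principal value is that of a bounded integrand. *)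
Lemma liE (x : R) : 1 < x ->
  li x = ln (x - 1) + \int[mu]_(t in `[0, x]) regular_part t.
Proof.
move=> x1; rewrite /li; apply: cvg_lim => //.
set l := _ + _; apply/cvgrPdist_le => eps eps0.
near=> e.
have e0 : 0 < e by near: e; exact: nbhs_right_gt.
have e1 : e < 1 by near: e; exact: nbhs_right_lt.
have ex : e < x - 1 by near: e; apply: nbhs_right_lt; lra.
(* The removed window has length [2 * e] and the regular part lies in [[0, 1]], so the error is at
   most [2 * e]. *)
have e_eps : e < eps / 2 by near: e; apply: nbhs_right_lt; rewrite divr_gt0.
have punctured : `[0, x] `\` `]1 - e, 1 + e[ = `[0, 1 - e] `|` `[1 + e, x] :> set R.
  by apply: itv_setD_punctured; lra.
have v1 : \int[mu]_(t in `[0, 1 - e]) (t - 1)^-1 = ln (- 1 * (1 - e - 1)) - ln (- 1 * (0 - 1)).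
  by apply: Rintegral_inv_subr1 => [||t /andP[]]; lra.
have v2 : \int[mu]_(t in `[1 + e, x]) (t - 1)^-1 = ln (1 * (x - 1)) - ln (1 * (1 + e - 1)).
  by apply: Rintegral_inv_subr1 => [||t /andP[]]; lra.
set D := `[0, x] `\` _ in punctured *.
have mD : measurable D by rewrite /D; exact: measurableD.
have Dx : D `<=` `[0, x] by move=> t [].
have ig := integrable_regular_part mD Dx.
have idisj : [disjoint `[0, 1 - e] & `[1 + e, x]].
  apply/disj_setPS => t /= []; rewrite !in_itv /=.
  by move=> /andP[_ h1] /andP[h2 _]; lra.
have ipole : mu.-integrable D (EFin \o (fun t => (t - 1)^-1)).
  rewrite punctured; apply: continuous_compact_integrable.
    by apply: compactU; exact: segment_compact.
  apply: continuous_in_subspaceT => t; rewrite inE /= !in_itv /= => tD.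
  apply: cvgV; last by apply: cvgB; [exact: cvg_id|exact: cvg_cst].
  by apply/eqP => t1; case: tD => /andP[]; lra.
have -> : \int[mu]_(t in D) (ln t)^-1 = ln (x - 1) + \int[mu]_(t in D) regular_part t.
  transitivity (\int[mu]_(t in D) ((t - 1)^-1 + regular_part t)).
    by apply: eq_Rintegral => t _; rewrite /regular_part addrC subrK.
  rewrite RintegralD//; congr (_ + _).
  rewrite punctured Rintegral_setU//; last by rewrite -punctured.
  rewrite v1 v2 !mul1r !mulN1r (_ : - (0 - 1) = 1); last by ring.
  rewrite (_ : - (1 - e - 1) = e); last by ring.
  by rewrite (_ : 1 + e - 1 = e) ?ln1; ring.
have split_x : [set` `[0, x]] = D `|` `]1 - e, 1 + e[.
  rewrite /D setDKU//; apply/subset_itvP; apply: subset_itvW; lra.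
have -> : l = ln (x - 1) + \int[mu]_(t in D) regular_part t +
    \int[mu]_(t in `]1 - e, 1 + e[) regular_part t.
  rewrite /l -addrA; congr (_ + _); rewrite {1}split_x Rintegral_setU//.
    by rewrite -split_x; exact: (@integrable_regular_part x).
  by apply/disj_setPS => t [] [].
have sub : `]1 - e, 1 + e[ `<=` `[0, x].
  by rewrite split_x; exact: subsetUr.
have /andP[r0 r1] := Rintegral_regular_part_itv sub.
rewrite fine_lebesgue_measure_itv in r1; last by lra.
rewrite addrAC subrr add0r ger0_norm//; lra.
Unshelve. all: by end_near. Qed.

Lemma Rintegral_regular_part_cat (x y : R) : 0 <= y -> y <= x ->
  \int[mu]_(t in `[0, x]) regular_part t =
  \int[mu]_(t in `[0, y]) regular_part t + \int[mu]_(t in `]y, x]) regular_part t.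
Proof.
move=> y0 yx; have E : [set` `[0, x]] = `[0, y] `|` `]y, x].
  by rewrite -itv_bndbnd_setU ?bnd_simp.
rewrite E Rintegral_setU//.
  by rewrite -E; apply: (@integrable_regular_part x).
apply/disj_setPS => t /= []; rewrite !in_itv /= => /andP[_ h1] /andP[h2 _]; lra.
Qed.

(** On [[0, y]] the regular part is only known to lie in [[0, 1]]; on []y, x]] the monotonicity of
    [ln t] and [t - 1] bounds it. The cut [y] is free, to be taken small against [x / ln x] but with
    [ln y] close to [ln x]. *)
Lemma li_bounds (x y : R) : 1 < y -> y <= x ->
  ln (x - 1) + (x - y) * ((ln x)^-1 - (y - 1)^-1) <= li x <=
  ln (x - 1) + y + (x - y) / ln y.
Proof.
move=> y1 yx; rewrite liE; last by lra.
rewrite (@Rintegral_regular_part_cat x y)//; last by lra.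
have sy : `[0, y] `<=` `[0, x].
  by move=> t /=; rewrite !in_itv /= => /andP[-> ty]; exact: le_trans yx.
have syx : `]y, x] `<=` `[0, x].
  by move=> t /=; rewrite !in_itv /= => /andP[yt ->]; rewrite andbT; lra.
have /andP[j0 j1] := Rintegral_regular_part_itv sy.
rewrite fine_lebesgue_measure_itv ?subr0 in j1; last by lra.
have icst (c : R) : mu.-integrable `]y, x] (EFin \o cst c).
  apply: (@integrableS _ _ _ mu `[0, x]) => //.
  apply: continuous_compact_integrable; first exact: segment_compact.
  by apply: continuous_subspaceT => ?; exact: cvg_cst.
have ireg := integrable_regular_part (measurable_itv _ : measurable `]y, x]) syx.
have ly : 0 < ln y by rewrite ln_gt0.
have up : \int[mu]_(t in `]y, x]) regular_part t <= (ln y)^-1 * (x - y).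
  rewrite -(fine_lebesgue_measure_itv false false yx) -Rintegral_cst//.
  apply: le_Rintegral => //; first exact: icst.
  move=> t /=; rewrite in_itv /= => /andP[yt tx].
  have : (ln t)^-1 <= (ln y)^-1.
    by rewrite lef_pV2 ?posrE ?ler_ln ?posrE ?ln_gt0//; lra.
  have : 0 <= (t - 1)^-1 by rewrite invr_ge0; lra.
  by rewrite /regular_part; lra.
have lo : ((ln x)^-1 - (y - 1)^-1) * (x - y) <= \int[mu]_(t in `]y, x]) regular_part t.
  rewrite -(fine_lebesgue_measure_itv false false yx) -Rintegral_cst//.
  apply: le_Rintegral => //; first exact: icst.
  move=> t /=; rewrite in_itv /= => /andP[yt tx].
  have : (ln x)^-1 <= (ln t)^-1.
    by rewrite lef_pV2 ?posrE ?ler_ln ?posrE ?ln_gt0//; lra.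
  have : (t - 1)^-1 <= (y - 1)^-1 by rewrite lef_pV2 ?posrE; lra.
  by rewrite /regular_part; lra.
rewrite ![(x - y) * _]mulrC; clear icst ireg sy syx; move: j0 j1 up lo.
move: (\int[mu]_(t in `[0, y]) _) (\int[mu]_(t in `]y, x]) _) => I1 I2.
by move=> *; apply/andP; split; lra.
Qed.

End LogarithmicIntegral.

(** * The limit law *)

Section LiAsymptotics.
Context (R : realType).
Local Notation L n := (ln (n%:R : R)).

Lemma cvgn_li : li (n%:R : R) / (n%:R / L n) @[n --> \oo] --> (1 : R).
Proof.
(* With the cut [y = n / L n ^+ 2] one has [ln y = L n * lny n]; [up] and [lo] below come from
   [li_bounds] divided by [n / L n]. *)
pose lny n := 1 - ln (L n) / L n * 2.
have lny1 : lny n @[n --> \oo] --> (1 - 0 * 2 : R).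
  apply: cvgB; first exact: cvg_cst.
  by apply: cvgMl; exact: cvgn_lnln_div.
rewrite mul0r subr0 in lny1.
have up : L n ^+ 2 / n%:R + (L n)^-1 + (lny n)^-1 @[n --> \oo] --> (0 + 0 + 1^-1 : R).
  apply: cvgD; last by apply: cvgV => //; exact: oner_neq0.
  by apply: cvgD; [exact: cvgnr_ln_pow_div|exact: cvgn_invln].
have lo : (1 - (L n)^-1 * (L n)^-1) * (1 - L n ^+ 3 / n%:R / (1 - L n ^+ 2 / n%:R))
    @[n --> \oo] --> ((1 - 0 * 0) * (1 - 0 / (1 - 0)) : R).
  apply: cvgM; apply: cvgB; try exact: cvg_cst.
    by apply: cvgM; exact: cvgn_invln.
  apply: cvgM; first exact: cvgnr_ln_pow_div.
  apply: cvgV; first by rewrite subr0 oner_neq0.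
  by apply: cvgB; [exact: cvg_cst|exact: cvgnr_ln_pow_div].
rewrite !add0r invr1 in up; rewrite !mul0r !subr0 mul1r in lo.
apply: (squeeze_cvgr _ lo up); near=> n.
have n2 : (2 <= n)%N by near: n; exact: nbhs_infty_ge.
have n2' : 2 <= (n%:R : R) by rewrite ler_nat.
have n0 : 0 < (n%:R : R) by lra.
have L1 : 2 <= L n by near: n; exact: near_ln_ge.
have L0 : 0 < L n by lra.
have lny_gt : 2^-1 <= lny n by near: n; apply: (cvgr_ge _ lny1); rewrite invf_lt1//; lra.
have l2n : L n ^+ 2 / n%:R <= 3^-1.
  by near: n; apply: (cvgr_le _ (@cvgnr_ln_pow_div R 2)); rewrite invr_gt0.
have l2n0 : 0 < L n ^+ 2 / n%:R by rewrite divr_gt0 ?exprn_gt0.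
pose y := n%:R / L n ^+ 2.
have y3 : 3 <= y.
  by rewrite -[leRHS]invf_div -[leLHS]invrK lef_pV2 ?posrE ?invr_gt0.
have y1 : 1 < y by lra.
have yn : y <= n%:R.
  rewrite /y ler_pdivrMr ?exprn_gt0// ler_peMr ?(ltW n0)//.
  by rewrite exprn_ege1//; lra.
have lnyE : ln y = L n * lny n.
  rewrite /y ln_div ?posrE ?exprn_gt0// lnXn// /lny; field.
  by rewrite gt_eqF.
have /andP[lo_li up_li] := li_bounds y1 yn.
have c0 : 0 < n%:R / L n by rewrite divr_gt0.
have l1 : 0 <= ln (n%:R - 1 : R) by rewrite ln_ge0//; lra.
have l1' : ln (n%:R - 1 : R) <= L n by rewrite ler_ln ?posrE//; lra.
apply/andP; split.
  rewrite ler_pdivlMr//; apply: le_trans lo_li.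
  rewrite -[leLHS]add0r lerD// le_eqVlt; apply/orP; left; apply/eqP.
  have d1 : n%:R - L n ^+ 2 != 0.
    rewrite gt_eqF// subr_gt0; move: y1; rewrite /y ltr_pdivlMr ?exprn_gt0//.
    by rewrite mul1r.
  by rewrite /y; field; rewrite mulN1r d1 !gt_eqF.
rewrite ler_pdivrMr//; apply: (le_trans up_li).
have lny0 : 0 < lny n by lra.
rewrite [leRHS](_ : _ = L n + y + n%:R / (L n * lny n)); last first.
  by rewrite /y; field; rewrite !gt_eqF.
rewrite -lnyE -!addrA lerD// lerD2l ler_wpM2r ?invr_ge0 ?gerBl//; last lra.
by rewrite lnyE mulr_ge0 ?ltW.
Unshelve. all: by end_near. Qed.

Lemma cvgn_ln_li : ln (li (n%:R : R)) / L n @[n --> \oo] --> (1 : R).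
Proof.
have h1 : ln (li (n%:R : R) / (n%:R / L n)) @[n --> \oo] --> ln (1 : R).
  by apply: continuous_cvg; [exact: continuous_ln|exact: cvgn_li].
have h : ln (li (n%:R : R) / (n%:R / L n)) / L n + 1 - ln (L n) / L n
    @[n --> \oo] --> (ln 1 * 0 + 1 - 0 : R).
  apply: cvgB; last exact: cvgn_lnln_div.
  apply: cvgD; last exact: cvg_cst.
  by apply: cvgM => //; exact: cvgn_invln.
rewrite mulr0 add0r subr0 in h; apply: cvg_trans h; apply: near_eq_cvg; near=> n.
have n0 : 0 < (n%:R : R) by rewrite ltr0n; near: n; exact: nbhs_infty_gt.
have L0 : 0 < L n by near: n; apply: filterS (near_ln_ge 1) => n; lra.
have li0 : 0 < li (n%:R : R).
  have : 2^-1 <= li (n%:R : R) / (n%:R / L n).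
    by near: n; apply: (cvgr_ge _ cvgn_li); rewrite invf_lt1//; lra.
  rewrite ler_pdivlMr ?divr_gt0// => /(lt_le_trans _); apply.
  by rewrite mulr_gt0 ?invr_gt0 ?divr_gt0.
rewrite !ln_div ?posrE ?divr_gt0//; field; rewrite gt_eqF//.
Unshelve. all: by end_near. Qed.

End LiAsymptotics.

(** * The double exponential limit for the longest run *)

Section CramerLimit.
Context (R : realType) (d : measure_display) (T : measurableType d)
  (P : probability T R) (X : nat -> {RV P >-> bool}) (hX : cramer_model X).
Local Notation L n := (ln (n%:R : R)).
Local Notation p := (prime_prob X).
Local Notation M := (typical_run p).

Let p0 k : 0 <= p k := prime_prob_ge0 X k.
Let p1 k : p k <= 1 := prime_prob_le1 X k.
Let p_ln := prime_prob_ln hX.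

(** The delayed recursion is applied with [eta = (1 - (L n)^-1) ^+ m], which bounds the probability
    of each admissible run start. *)
Lemma pr_no_run_approx m n : (3 <= n)%N ->
  0 <= expR (- mean_runs p m n) - pr X (no_run m (n - m).+1) <=
    m.+1%:R * expR (- (m%:R / L n)) * mean_runs p m n.
Proof.
move=> n3; have L1 := ln_nat_ge1 p1 p_ln n3.
have q0 := onem_invln_ge0 p1 p_ln n3.
have S0 : 0 <= mean_runs p m n by apply: mean_runs_ge0.
have /andP[h0 h1] : 0 <= expR (- \sum_(2 <= j < (n - m).+1) run_prob p m j) -
    pr X (no_run m (n - m).+1) <= m.+1%:R * (1 - (L n)^-1) ^+ m *
    \sum_(2 <= j < (n - m).+1) run_prob p m j.
  apply: (@delayed_recursion_approx R (fun N => pr X (no_run m N))).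
  - by move=> i; rewrite pr_ge0 (@pr_le1 _ _ _ _ _ _ _ (@depends_on_no_run m i)).
  - by move=> i j ij; exact: pr_no_run_le.
  - by move=> i i2; exact: pr_no_run_small.
  - by move=> i i2; exact: pr_no_run_rec.
  - by move=> i; exact: run_prob_ge0.
  - by move=> i hi; apply: run_prob_le => //; lia.
  - rewrite exprn_ge0//= exprn_ile1//.
    by rewrite gerBl invr_ge0; lra.
rewrite h0/=; apply: (le_trans h1).
by rewrite ler_wpM2r// ler_wpM2l// onem_exp_le_expR.
Qed.

(** The mean tends to [expR (- z)], and the approximation error is of order at most [L n ^+ 3 / n]:
    a factor [L n ^+ 2] from [m n] and [L n / n] from the exponential. *)
Lemma cvgn_longest_run_lt (m : nat -> nat) (z : R) :
  ((m n)%:R - (M n)%:R) / L n @[n --> \oo] --> z ->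
  P [set w | (longest_run X n w < m n)%N] @[n --> \oo] -->
    (expR (- expR (- z)))%:E.
Proof.
move=> mz.
have lam := cvgn_mean_runs p0 p1 p_ln mz.
have mL2 : (m n)%:R / L n ^+ 2 @[n --> \oo] --> (z * 0 + 1 : R).
  have h : ((m n)%:R - (M n)%:R) / L n * (L n)^-1 + (M n)%:R / L n ^+ 2
      @[n --> \oo] --> (z * 0 + 1 : R).
    apply: cvgD; last exact: cvgn_typical_run.
    by apply: cvgM => //; exact: cvgn_invln.
  apply: cvg_trans h; apply: near_eq_cvg; near=> n.
  have L0 : 0 < L n by near: n; apply: filterS (near_ln_ge 1) => n; lra.
  by field; rewrite gt_eqF.
rewrite mulr0 add0r in mL2.
(* The bound known at [M n] is carried to [m n] using [(m n - M n) / L n >= z - 1], valid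
   eventually. *)
pose K : R := 4 * expR 12 * expR (- (z - 1)).
have err0 : ((m n)%:R / L n ^+ 2 + (L n)^-1 * (L n)^-1) *
    (K * (L n ^+ 3 / n%:R)) * mean_runs p (m n) n @[n --> \oo] -->
    ((1 + 0 * 0) * (K * 0) * expR (- z) : R).
  apply: cvgM => //; apply: cvgM; last by apply: cvgMr; exact: cvgnr_ln_pow_div.
  by apply: cvgD => //; apply: cvgM; exact: cvgn_invln.
have up : expR (- mean_runs p (m n) n) @[n --> \oo] --> expR (- expR (- z)).
  by apply: continuous_cvg; [exact: continuous_expR|exact: cvgN].
have lo : expR (- mean_runs p (m n) n) - ((m n)%:R / L n ^+ 2 + (L n)^-1 * (L n)^-1) *
    (K * (L n ^+ 3 / n%:R)) * mean_runs p (m n) n @[n --> \oo] -->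
    (expR (- expR (- z)) - (1 + 0 * 0) * (K * 0) * expR (- z) : R).
  exact: cvgB.
rewrite !mulr0 mul0r subr0 in lo.
have prcvg : pr X (no_run (m n) (n - m n).+1) @[n --> \oo] --> expR (- expR (- z)).
  apply: (squeeze_cvgr _ lo up); near=> n.
  have n3 : (3 <= n)%N by near: n; exact: nbhs_infty_ge.
  have L0 : 0 < L n by near: n; apply: filterS (near_ln_ge 1) => n; lra.
  have n0 : 0 < (n%:R : R) by rewrite ltr0n; lia.
  have /andP[a1 a2] := pr_no_run_approx (m n) n3.
  rewrite -subr_ge0 in a1.
  have E : expR (- ((m n)%:R / L n)) <= K * (L n / n%:R).
    have -> : - ((m n)%:R / L n) = - ((M n)%:R / L n) - ((m n)%:R - (M n)%:R) / L n.
      by field; rewrite gt_eqF.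
    rewrite expRD /K mulrAC; apply: ler_pM; rewrite ?expR_ge0//.
      by near: n; exact: near_typical_run_bound.
    by rewrite ler_expR lerN2; near: n; apply: (cvgr_ge _ mz); lra.
  have l0 : 0 <= mean_runs p (m n) n by exact: mean_runs_ge0.
  have a3 : (m n).+1%:R * expR (- ((m n)%:R / L n)) * mean_runs p (m n) n <=
      ((m n)%:R / L n ^+ 2 + (L n)^-1 * (L n)^-1) * (K * (L n ^+ 3 / n%:R)) *
      mean_runs p (m n) n.
    rewrite ler_wpM2r//; apply: (le_trans (ler_wpM2l _ E)) => //.
    rewrite -natr1 le_eqVlt; apply/orP; left; apply/eqP; field.
    by rewrite !gt_eqF.
  by apply/andP; split; lra.
have : (pr X (no_run (m n) (n - m n).+1))%:E @[n --> \oo] -->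
    (expR (- expR (- z)))%:E.
  by apply: cvg_EFin => //; near=> n.
apply: cvg_trans; apply: near_eq_cvg; near=> n.
rewrite (prob_longest_run_lt hX)//; have [m0|//] := posnP (m n).
have : 2^-1 <= (m n)%:R / L n ^+ 2.
  by near: n; apply: (cvgr_ge _ mL2); rewrite invf_lt1//; lra.
by rewrite m0 mul0r; lra.
Unshelve. all: by end_near. Qed.

End CramerLimit.

Theorem theorem1 (R : realType) (d : measure_display) (T : measurableType d)
    (P : probability T R) (X : nat -> {RV P >-> bool})
    (hX : cramer_model X) :
  let alpha := fun n : nat => n%:R / li (n%:R : R) in
  exists a b : nat -> R,
    (forall n, 0 < a n) /\
    asymp_equiv a alpha /\
    asymp_equiv b (fun n => alpha n * ln (li (n%:R : R))) /\
    (forall z : R,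
      P [set w | (maximal_gap X n w)%:R <= a n * z + b n] @[n --> \oo]
        --> (expR (- expR (- z)))%:E) /\
    (forall z : R,
      P [set w | (longest_run X n w)%:R <= a n * z + b n] @[n --> \oo]
        --> (expR (- expR (- z)))%:E).
Proof.
have p0 k : 0 <= prime_prob X k := prime_prob_ge0 X k.
have p1 k : prime_prob X k <= 1 := prime_prob_le1 X k.
have p_ln := prime_prob_ln hX.
set M := typical_run (prime_prob X).
have ML : (M n)%:R / ln n%:R ^+ 2 @[n --> \oo] --> (1 : R).
  exact: cvgn_typical_run p0 p1 p_ln.
(* [ln n] vanishes at [n = 0] and [n = 1], where [a n] must still be positive. *)
pose a n : R := if (2 <= n)%N then ln n%:R else 1.
have aE : \forall n \near \oo, a n = ln n%:R.
  by near=> n; rewrite /a ifT//; near: n; exact: nbhs_infty_ge.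
have near_ln_gt0 : \forall n \near \oo, 0 < ln (n%:R : R).
  by apply: filterS (near_ln_ge 1) => n; lra.
move=> alpha; exists a, (fun n => (M n)%:R); split; [|split; [|split]].
- move=> n; rewrite /a; case: ifP => // n2.
  by rewrite ln_gt0// ltr1n.
- have h := @cvgn_li R; apply: cvg_trans h; apply: near_eq_cvg; near=> n.
  have -> : a n = ln n%:R by near: n.
  by rewrite /alpha !invf_div mulrC -!mulrA; congr (_ * _); rewrite mulrC.
- have h : (M n)%:R / ln n%:R ^+ 2 *
      ((li (n%:R : R) / (n%:R / ln n%:R)) / (ln (li (n%:R : R)) / ln n%:R)) @[n --> \oo] -->
      (1 * (1 / 1) : R).
    apply: cvgM => //; apply: cvgM; first exact: cvgn_li.
    by apply: cvgV; [exact: oner_neq0|exact: cvgn_ln_li].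
  rewrite divr1 mulr1 in h; apply: cvg_trans h; apply: near_eq_cvg; near=> n.
  have L0 : 0 < ln (n%:R : R) by near: n.
  (* Abstracting the inverses of [ln (li n)] and [n] leaves [L n != 0] as the only condition for
     [field]. *)
  rewrite /alpha !invfM !invrK.
  by move: (ln (li n%:R))^-1 (n%:R : R)^-1 => u v; field; rewrite gt_eqF.
have t_ge1 z : \forall n \near \oo, 1 <= a n * z + (M n)%:R.
  have h : z * (ln (n%:R : R))^-1 + (M n)%:R / ln n%:R ^+ 2 @[n --> \oo] --> (z * 0 + 1 : R).
    by apply: cvgD => //; apply: cvgMr; exact: cvgn_invln.
  rewrite mulr0 add0r in h; near=> n.
  have L0 : 0 < ln (n%:R : R) by near: n.
  have L2 : 2 <= ln (n%:R : R) by near: n; exact: near_ln_ge.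
  have -> : a n = ln n%:R by near: n.
  have : 2^-1 <= z * (ln (n%:R : R))^-1 + (M n)%:R / ln n%:R ^+ 2.
    by near: n; apply: (cvgr_ge _ h); rewrite invf_lt1//; lra.
  rewrite -(ler_pM2r (_ : 0 < ln (n%:R : R) ^+ 2)) ?exprn_gt0//.
  have -> : (z * (ln (n%:R : R))^-1 + (M n)%:R / ln n%:R ^+ 2) * ln n%:R ^+ 2 =
      ln n%:R * z + (M n)%:R by field; rewrite gt_eqF.
  apply: le_trans; rewrite ler_pdivlMl// mulr1.
  by apply: (le_trans L2); rewrite expr2 ler_peMr//; lra.
(* Rounding and the shift [c] change the threshold by a bounded amount, negligible against [ln n];
   [c] is 0 for gaps and 1 for runs. *)
have main z (c : nat) : P [set w | (longest_run X n w < Num.truncn (a n * z + (M n)%:R) + c)%N]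
    @[n --> \oo] --> (expR (- expR (- z)))%:E.
  apply: (cvgn_longest_run_lt hX).
  have lo : z - (ln (n%:R : R))^-1 @[n --> \oo] --> (z - 0 : R).
    by apply: cvgB; [exact: cvg_cst|exact: cvgn_invln].
  have up : z + c%:R * (ln (n%:R : R))^-1 @[n --> \oo] --> (z + c%:R * 0 : R).
    by apply: cvgD; [exact: cvg_cst|apply: cvgMr; exact: cvgn_invln].
  rewrite subr0 in lo; rewrite mulr0 addr0 in up.
  apply: (squeeze_cvgr _ lo up); near=> n.
  have L0 : 0 < ln (n%:R : R) by near: n.
  have := _ : 1 <= a n * z + (M n)%:R; move=> /(_ ltac:(near: n; exact: t_ge1)).
  have -> : a n = ln n%:R by near: n.
  set t := _ + _ => t1; have t0 : 0 <= t by lra.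
  have /andP[h1 h2] := truncn_itv t0.
  have Ln0 : ln (n%:R : R) != 0 by rewrite gt_eqF.
  rewrite ler_pdivlMr// ler_pdivrMr// natrD mulrBl (mulrDl z) -mulrA.
  rewrite !mulVf// mulr1 (mulrC z).
  move: h2; rewrite -natr1; have c0 : 0 <= (c%:R : R) by [].
  by rewrite /t in h1 *; move=> h2; apply/andP; split; lra.
have event_eq (f : nat -> T -> nat) z c :
    (forall n w, 1 <= a n * z + (M n)%:R ->
      ((f n w)%:R <= a n * z + (M n)%:R) =
      (longest_run X n w < Num.truncn (a n * z + (M n)%:R) + c)%N) ->
    P [set w | (f n w)%:R <= a n * z + (M n)%:R] @[n --> \oo] -->
      (expR (- expR (- z)))%:E.
  move=> fE; apply: cvg_trans (main z c); apply: near_eq_cvg; near=> n.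
  congr (P _); apply/seteqP; split=> w /=; rewrite fE//; by near: n; exact: t_ge1.
(* For [t >= 0] with integer part [q], [R + 1 <= t] means [R < q], and [R <= t] means
   [R < q + 1]. *)
split=> z.
  apply: (event_eq _ z 0%N) => n w t1.
  by rewrite addn0 /maximal_gap -truncn_ge_nat//; lra.
apply: (event_eq _ z 1%N) => n w t1.
by rewrite addn1 ltnS truncn_ge_nat//; lra.
Unshelve. all: by end_near. Qed.
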